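(* Let $0<r_1<r_2<\infty$. (a) Let $\phi:\{r_1,r_2\}\times\mathbb{R}\to\mathbb{R}$ be continuous, $2\pi$-periodic in the second argument, satisfy the Dirichlet conditions as a function of $\theta$, and satisfy $r_1\phi(r_1,\theta)=r_2\phi(r_2,\theta)$ for all $\theta\in\mathbb{R}$. If $U$ is the solution of the polar Neumann problem with boundary data $\phi$ satisfying $U(\sqrt{r_1r_2},0)=0$, then $$U(r,\theta)=\int_{\frac{\sqrt{r_1r_2}}{r}}^{1}\frac{u(r\rho,\theta)}{\rho}\,d\rho,\qquad (r,\theta)\in[r_1,r_2]\times\mathbb{R},$$ where $u$ is the solution of the polar Dirichlet problem with boundary values $\varphi(r,\theta)=r\phi(r,\theta)$ on $\{r_1,r_2\}\times\mathbb{R}$. (b) Conversely, let $\varphi:\{r_1,r_2\}\times\mathbb{R}\to\mathbb{R}$ be continuous, $2\pi$-periodic in the second variable, and satisfy $\int_0^{2\pi}\varphi(r_1,\theta)\,d\theta=\int_0^{2\pi}\varphi(r_2,\theta)\,d\theta$. If $U$ is a solution of the polar Neumann problem with boundary data $\phi(r,\theta)=\varphi(r,\theta)/r$, $r\in\{r_1,r_2\}$, then $u(r,\theta)=rU_r(r,\theta)$, $(r,\theta)\in[r_1,r_2]\times\mathbb{R}$, is the solution of the polar Dirichlet problem with boundary data $\varphi$.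
   Context: Polar Dirichlet problem with data $\varphi$: find $u\in C^2((r_1,r_2)\times\mathbb{R})\cap C^0([r_1,r_2]\times\mathbb{R})$, $2\pi$-periodic in the second variable $\theta$, with $u_{rr}+\frac1r u_r+\frac1{r^2}u_{\theta\theta}=0$ in $(r_1,r_2)\times\mathbb{R}$ and $u=\varphi$ on $\{r_1,r_2\}\times\mathbb{R}$. Polar Neumann problem with data $\phi$: find $U\in C^2((r_1,r_2)\times\mathbb{R})\cap C^1([r_1,r_2]\times\mathbb{R})$, $2\pi$-periodic in $\theta$, with $U_{rr}+\frac1r U_r+\frac1{r^2}U_{\theta\theta}=0$ in $(r_1,r_2)\times\mathbb{R}$ and $U_r=\phi$ on $\{r_1,r_2\}\times\mathbb{R}$. ($C^1$ on a closed set means that the first order partial derivatives extend continuously to it.) ''Dirichlet conditions'' are the classical conditions for pointwise convergence of Fourier series: on a period the function is bounded, has finitely many local extrema and finitely many discontinuities (of the first kind). *)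

(* Defs.v *)
From Stdlib Require Import Reals List.
From Coquelicot Require Import Coquelicot.
Open Scope R_scope.

(* Polar coordinates: every function of [(r, theta)] is a total function
   [R -> R -> R], of which only the values on the closed strip
   [r1, r2] x R (for boundary data: on {r1, r2} x R) are ever used. *)

Definition open_strip (r1 r2 : R) (p : R * R) : Prop := r1 < fst p < r2.
Definition closed_strip (r1 r2 : R) (p : R * R) : Prop := r1 <= fst p <= r2.
Definition strip_boundary (r1 r2 : R) (p : R * R) : Prop :=
  fst p = r1 \/ fst p = r2.

Definition jointly_continuous_on (D : R * R -> Prop) (f : R -> R -> R) : Prop :=
  continuous_on D (fun p : R * R => f (fst p) (snd p)).

(* [ex_diff_n f n x y]: all partial derivatives of order at most [n] exist and
   are continuous at [(x, y)]. *)
Definition Cn_on (n : nat) (D : R * R -> Prop) (f : R -> R -> R) : Prop :=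
  forall x y, D (x, y) -> ex_diff_n f n x y.

Definition periodic_on (D : R * R -> Prop) (f : R -> R -> R) : Prop :=
  forall r theta, D (r, theta) -> f r (theta + 2 * PI) = f r theta.

Definition polar_laplace_eq (D : R * R -> Prop) (f : R -> R -> R) : Prop :=
  forall r theta, D (r, theta) ->
    partial_derive 2 0 f r theta
    + / r * partial_derive 1 0 f r theta
    + / r ^ 2 * partial_derive 0 2 f r theta = 0.

(* [G] is the (unique) continuous extension to the closed strip of [g], the
   values of [g] outside the open strip being ignored. *)
Definition continuous_extension (r1 r2 : R) (g G : R -> R -> R) : Prop :=
  jointly_continuous_on (closed_strip r1 r2) G /\
  forall r theta, open_strip r1 r2 (r, theta) -> G r theta = g r theta.

Definition dirichlet_solution (r1 r2 : R) (phi u : R -> R -> R) : Prop :=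
  Cn_on 2 (open_strip r1 r2) u /\
  jointly_continuous_on (closed_strip r1 r2) u /\
  periodic_on (closed_strip r1 r2) u /\
  polar_laplace_eq (open_strip r1 r2) u /\
  (forall r theta, strip_boundary r1 r2 (r, theta) -> u r theta = phi r theta).

Definition the_dirichlet_solution (r1 r2 : R) (phi u : R -> R -> R) : Prop :=
  dirichlet_solution r1 r2 phi u /\
  forall v, dirichlet_solution r1 r2 phi v ->
    forall r theta, closed_strip r1 r2 (r, theta) -> v r theta = u r theta.

(* [Ur] and [Ut] are the first order partial derivatives of [U] extended to the
   closed strip; on the boundary, [U_r] means the value of that extension. *)
Definition neumann_solution (r1 r2 : R) (phi U : R -> R -> R) : Prop :=
  Cn_on 2 (open_strip r1 r2) U /\
  jointly_continuous_on (closed_strip r1 r2) U /\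
  periodic_on (closed_strip r1 r2) U /\
  polar_laplace_eq (open_strip r1 r2) U /\
  exists Ur Ut : R -> R -> R,
    continuous_extension r1 r2 (partial_derive 1 0 U) Ur /\
    continuous_extension r1 r2 (partial_derive 0 1 U) Ut /\
    (forall r theta, strip_boundary r1 r2 (r, theta) ->
       Ur r theta = phi r theta).

Definition local_extremum (f : R -> R) (t : R) : Prop :=
  locally t (fun s => f s <= f t) \/ locally t (fun s => f t <= f s).

Definition constant_between (f : R -> R) (a b : R) : Prop :=
  forall s, Rmin a b <= s <= Rmax a b -> f s = f a.

(* Conditions on the period [0, 2 PI]. Local extrema are in the wide sense, so
   the points of an interval of constancy are all local extrema: such an
   interval counts as a single extremum, otherwise constants would be
   excluded. *)
Definition dirichlet_conditions (f : R -> R) : Prop :=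
  (exists M, forall t, 0 <= t <= 2 * PI -> Rabs (f t) <= M) /\
  (exists l : list R, forall t, 0 <= t <= 2 * PI -> local_extremum f t ->
     exists c, In c l /\ constant_between f c t) /\
  (exists l : list R, forall t, 0 <= t <= 2 * PI -> ~ continuous f t ->
     In t l) /\
  (forall t, 0 <= t <= 2 * PI -> ~ continuous f t ->
     exists a b : R,
       filterlim f (at_left t) (locally a) /\
       filterlim f (at_right t) (locally b)).

(* Main.v *)
Require Import Defs.
From Stdlib Require Import Reals List Lra Psatz.
From Coquelicot Require Import Coquelicot.
Open Scope R_scope.

(** [u = r U_r] solves the Dirichlet problem, but to know that it is [C^2] one
    needs that the [C^2] harmonic function [U] is smooth. Put [p = r U_r] and
    [q = U_t]; then [p - i q] is a holomorphic function of [ln r + i t] that is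
    periodic in [t], and Cauchy's formula on the periodic strip, with the kernel
    [coth (w / 2)], expresses [p] inside a strip through the values of [p] and
    [q] on two circles, with a kernel that is smooth away from these circles.
    Harmonicity of [p] follows from the Cauchy-Riemann equations. Uniqueness
    for the Dirichlet problem holds because [int w^2 dt] is a convex function of
    [ln r]. In (a), uniqueness gives [u = r U_r] and [u(r, t) = u(r1 r2 / r, t)];
    the latter forces [(r U_r)_r = 0], hence [U_tt = 0], on the circle
    [r = sqrt (r1 r2)], where [U] is then constant, and (a) is the integral of
    [U_r = u / r] from that circle. *)

(** The obstacle is one derivative: [r U_r] must have continuous derivatives up to order 2, hence
    [U] up to order 3, while only two orders are given. The pair [(p, q)] gets around this because
    its first order system involves second derivatives of [U] only. [coth (w / 2)] is the
    [2 PI i]-periodic analogue of [2 / w], with one simple pole per period. No contour around the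
    pole is drawn: by periodicity, integrals over full circles do not depend on the radius on either
    side of the pole, and only the jump across it is to be found. The pole is approached along the
    circles [x l] and [x / l], symmetric in [ln r]: under this reflection the real part of the
    kernel changes sign and the imaginary part does not, so that values of [p] add up while values
    of [q] nearly cancel. In (a), [sqrt (r1 r2)] is the fixed circle of the inversion
    [r -> r1 r2 / r], which exchanges the boundary circles, on which [r phi] takes equal values. *)

(** * Sections of continuous functions, parameter integrals, integrals over a period *)

Lemma continuity_2d_pt_snd (f : R -> R -> R) (x y : R) :
  continuity_2d_pt f x y -> continuous (f x) y.
Proof.
  intros H; apply continuity_2d_pt_filterlim in H.
  apply filterlim_locally; intros eps.
  destruct (proj1 (filterlim_locally _ _) H eps) as [d Hd].
  exists d; intros z Hz; apply (Hd (x, z)).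
  split; [apply ball_center | exact Hz].
Qed.

Lemma continuity_2d_pt_fst (f : R -> R -> R) (x y : R) :
  continuity_2d_pt f x y -> continuous (fun s => f s y) x.
Proof.
  intros H; apply continuity_2d_pt_filterlim in H.
  apply filterlim_locally; intros eps.
  destruct (proj1 (filterlim_locally _ _) H eps) as [d Hd].
  exists d; intros z Hz; apply (Hd (z, y)).
  split; [exact Hz | apply ball_center].
Qed.

Lemma continuous_ex_RInt (f : R -> R) (c d : R) :
  (forall t, continuous f t) -> ex_RInt f c d.
Proof. intros H; apply (ex_RInt_continuous (V := R_CompleteNormedModule)); auto. Qed.

Lemma locally_open_interval (a b x : R) (P : R -> Prop) :
  a < x < b -> (forall s, a < s < b -> P s) -> locally x P.
Proof.
  intros Hx H.
  apply (locally_interval P x a b); simpl; try lra; intros; apply H; lra.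
Qed.

Lemma locally_2d_strip (a b x y : R) (P : R -> R -> Prop) :
  a < x < b -> (forall s t, a < s < b -> P s t) -> locally_2d P x y.
Proof.
  intros Hx H.
  assert (Hd : 0 < Rmin (x - a) (b - x)) by (apply Rmin_glb_lt; lra).
  exists (mkposreal _ Hd); simpl; intros u v Hu _; apply H.
  apply Rabs_def2 in Hu.
  pose proof (Rmin_l (x - a) (b - x)); pose proof (Rmin_r (x - a) (b - x)); lra.
Qed.

Lemma is_derive_RInt_strip (a b c d : R) (f fr : R -> R -> R) :
  (forall r t, a < r < b -> is_derive (fun s => f s t) r (fr r t)) ->
  (forall r t, a < r < b -> continuity_2d_pt f r t) ->
  (forall r t, a < r < b -> continuity_2d_pt fr r t) ->
  forall r, a < r < b ->
    is_derive (fun s => RInt (f s) c d) r (RInt (fr r) c d).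
Proof.
  intros Hd Hf Hfr r Hr.
  replace (RInt (fr r) c d)
    with (RInt (fun t => Derive (fun u => f u t) r) c d).
  2:{ apply RInt_ext; intros t _; apply is_derive_unique, Hd, Hr. }
  apply (is_derive_RInt_param f c d r).
  - apply (locally_open_interval a b); [exact Hr|]; intros s Hs t _.
    eexists; apply Hd, Hs.
  - intros t _.
    apply (continuity_2d_pt_ext_loc fr); [|now apply Hfr].
    apply (locally_2d_strip a b); [exact Hr|]; intros s u Hs.
    symmetry; apply is_derive_unique, Hd, Hs.
  - apply (locally_open_interval a b); [exact Hr|]; intros s Hs.
    apply continuous_ex_RInt; intros t.
    apply (continuity_2d_pt_snd f s t), Hf, Hs.
Qed.

Lemma RInt_periodic (f : R -> R) (T a : R) :
  (forall t, continuous f t) -> (forall t, f (t + T) = f t) ->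
  RInt f a (a + T) = RInt f 0 T.
Proof.
  intros Hc Hp.
  assert (E : forall u v, ex_RInt f u v) by (intros; now apply continuous_ex_RInt).
  assert (S : RInt f T (a + T) = RInt f 0 a).
  { pose proof (RInt_comp_lin f 1 T 0 a) as H.
    replace (1 * 0 + T) with T in H by ring.
    replace (1 * a + T) with (a + T) in H by ring.
    rewrite <- H by apply E.
    apply RInt_ext; intros t _.
    unfold scal; simpl; unfold mult; simpl.
    rewrite !Rmult_1_l; apply Hp. }
  pose proof (RInt_Chasles f a 0 T (E _ _) (E _ _)) as H1.
  pose proof (RInt_Chasles f a T (a + T) (E _ _) (E _ _)) as H2.
  pose proof (RInt_Chasles f 0 a 0 (E _ _) (E _ _)) as H3.
  rewrite RInt_point in H3.
  unfold plus, zero in *; simpl in *; lra.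
Qed.

Lemma is_derive_0_const (a b : R) (F : R -> R) :
  (forall r, a < r < b -> is_derive F r 0) ->
  forall x y, a < x < b -> a < y < b -> F x = F y.
Proof.
  intros H x y Hx Hy.
  destruct (MVT_gen F x y (fun _ => 0)) as [c [_ Hc]].
  - intros z Hz; apply H; revert Hz; unfold Rmin, Rmax; destruct Rle_dec; lra.
  - intros z Hz.
    assert (Hz' : a < z < b) by (revert Hz; unfold Rmin, Rmax; destruct Rle_dec; lra).
    apply continuity_pt_filterlim, (ex_derive_continuous F); eexists; apply H, Hz'.
  - lra.
Qed.

(** * Polar Cauchy-Riemann equations *)

(** The derivatives are explicit functions, so that [cr_pair] can state the Cauchy-Riemann equations
    by putting the radial derivative of one function in the place of the angular derivative of the
    other. *)
Definition C1_strip (a b : R) (f fr ft : R -> R -> R) : Prop :=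
  forall r t, a < r < b ->
    is_derive (fun s => f s t) r (fr r t) /\ is_derive (f r) t (ft r t) /\
    continuity_2d_pt f r t /\ continuity_2d_pt fr r t /\ continuity_2d_pt ft r t.

(* [r p_r = - q_t] and [r q_r = p_t]: they say that [p - i q] is a holomorphic function of [ln r + i t]. *)
Definition cr_pair (a b : R) (p q pr qr : R -> R -> R) : Prop :=
  C1_strip a b p pr (fun r t => r * qr r t) /\
  C1_strip a b q qr (fun r t => - (r * pr r t)) /\
  (forall r t, a < r < b -> p r (t + 2 * PI) = p r t) /\
  (forall r t, a < r < b -> q r (t + 2 * PI) = q r t).

Lemma cr_pair_sub (a b a' b' : R) (p q pr qr : R -> R -> R) :
  a <= a' -> b' <= b -> cr_pair a b p q pr qr -> cr_pair a' b' p q pr qr.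
Proof.
  intros Ha Hb (H1 & H2 & H3 & H4).
  split; [|split; [|split]].
  - intros r t Hr; apply H1; lra.
  - intros r t Hr; apply H2; lra.
  - intros r t Hr; apply H3; lra.
  - intros r t Hr; apply H4; lra.
Qed.

(** Multiplication by [i]: [i (p - i q) = q - i (- p)]. It transfers to [q] what is proved about
    [p]. *)
Lemma cr_pair_conj (a b : R) (p q pr qr : R -> R -> R) :
  cr_pair a b p q pr qr ->
  cr_pair a b q (fun r t => - p r t) qr (fun r t => - pr r t).
Proof.
  intros (H1 & H2 & H3 & H4); split; [|split; [|split]].
  - intros r t Hr; destruct (H2 r t Hr) as (A & B & C & D & E).
    split; [|split; [|split; [|split]]]; auto.
    + replace (r * - pr r t) with (- (r * pr r t)) by ring; exact B.
    + apply (continuity_2d_pt_ext (fun r t => - (r * pr r t))); [intros; ring|exact E].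
  - intros r t Hr; destruct (H1 r t Hr) as (A & B & C & D & E).
    split; [|split; [|split; [|split]]].
    + apply (is_derive_opp (fun s => p s t)); exact A.
    + apply (is_derive_opp (p r)); exact B.
    + now apply continuity_2d_pt_opp.
    + now apply continuity_2d_pt_opp.
    + now apply continuity_2d_pt_opp.
  - exact H4.
  - intros r t Hr; now rewrite H3.
Qed.

Lemma is_derive_Rmult (f g : R -> R) (x f' g' l : R) :
  is_derive f x f' -> is_derive g x g' -> l = f' * g x + f x * g' ->
  is_derive (fun s => f s * g s) x l.
Proof.
  intros Hf Hg ->. apply (is_derive_mult f g x); auto.
  intros; apply Rmult_comm.
Qed.

Lemma is_derive_Rminus (f g : R -> R) (x f' g' l : R) :
  is_derive f x f' -> is_derive g x g' -> l = f' - g' ->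
  is_derive (fun s => f s - g s) x l.
Proof. intros Hf Hg ->. apply (is_derive_minus f g x); auto. Qed.

Lemma is_derive_Rplus (f g : R -> R) (x f' g' l : R) :
  is_derive f x f' -> is_derive g x g' -> l = f' + g' ->
  is_derive (fun s => f s + g s) x l.
Proof. intros Hf Hg ->. apply (is_derive_plus f g x); auto. Qed.

Ltac cont2d :=
  repeat first [ assumption
    | apply continuity_2d_pt_id1 | apply continuity_2d_pt_id2
    | apply continuity_2d_pt_const
    | apply continuity_2d_pt_plus | apply continuity_2d_pt_minus
    | apply continuity_2d_pt_opp | apply continuity_2d_pt_mult ].

(** Products of holomorphic functions: [(p - i q)(P - i Q) = (p P - q Q) - i (p Q + q P)]. *)
Lemma cr_pair_mult (a b : R) (p q pr qr P Q Pr Qr : R -> R -> R) :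
  cr_pair a b p q pr qr -> cr_pair a b P Q Pr Qr ->
  cr_pair a b (fun r t => p r t * P r t - q r t * Q r t)
    (fun r t => p r t * Q r t + q r t * P r t)
    (fun r t => pr r t * P r t + p r t * Pr r t - (qr r t * Q r t + q r t * Qr r t))
    (fun r t => pr r t * Q r t + p r t * Qr r t + (qr r t * P r t + q r t * Pr r t)).
Proof.
  intros (H1 & H2 & H3 & H4) (K1 & K2 & K3 & K4); split; [|split; [|split]].
  - intros r t Hr; destruct (H1 r t Hr) as (A & B & C & D & E).
    destruct (H2 r t Hr) as (A' & B' & C' & D' & E').
    destruct (K1 r t Hr) as (a1 & b1 & c1 & d1 & e1).
    destruct (K2 r t Hr) as (a2 & b2 & c2 & d2 & e2).
    split; [|split; [|split; [|split]]]; try now cont2d.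
    + eapply is_derive_Rminus; [eapply is_derive_Rmult; eauto | eapply is_derive_Rmult; eauto | ring].
    + eapply is_derive_Rminus; [eapply is_derive_Rmult; eauto | eapply is_derive_Rmult; eauto | simpl; ring].
  - intros r t Hr; destruct (H1 r t Hr) as (A & B & C & D & E).
    destruct (H2 r t Hr) as (A' & B' & C' & D' & E').
    destruct (K1 r t Hr) as (a1 & b1 & c1 & d1 & e1).
    destruct (K2 r t Hr) as (a2 & b2 & c2 & d2 & e2).
    split; [|split; [|split; [|split]]]; try now cont2d.
    + eapply is_derive_Rplus; [eapply is_derive_Rmult; eauto | eapply is_derive_Rmult; eauto | ring].
    + eapply is_derive_Rplus; [eapply is_derive_Rmult; eauto | eapply is_derive_Rmult; eauto | simpl; ring].
  - intros r t Hr; now rewrite H3, H4, K3, K4.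
  - intros r t Hr; now rewrite H3, H4, K3, K4.
Qed.

(** Cauchy's theorem on circles: the derivative in [r] is the integral of [p_r = - q_t / r], which
    vanishes because [q] is periodic. *)
Lemma cr_pair_mean_const (a b : R) (p q pr qr : R -> R -> R) :
  0 <= a -> cr_pair a b p q pr qr ->
  forall x y, a < x < b -> a < y < b ->
    RInt (p x) 0 (2 * PI) = RInt (p y) 0 (2 * PI).
Proof.
  intros Ha (H1 & H2 & H3 & H4) x y Hx Hy.
  apply (is_derive_0_const a b (fun r => RInt (p r) 0 (2 * PI))); auto.
  intros r Hr.
  assert (I : is_RInt (fun t => - (r * pr r t)) 0 (2 * PI) (minus (q r (2 * PI)) (q r 0))).
  { apply (is_RInt_derive (q r)); intros t _.
    - now apply H2.
    - apply (continuity_2d_pt_snd (fun r t => - (r * pr r t))); now apply H2. }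
  assert (E : RInt (pr r) 0 (2 * PI) = 0).
  { apply is_RInt_unique.
    replace (q r (2 * PI)) with (q r 0) in I
      by (rewrite <- (H4 r 0) by lra; f_equal; ring).
    apply (is_RInt_scal _ _ _ (- / r)) in I.
    evar_last; [eapply is_RInt_ext; [|exact I]|].
    - intros t _; unfold scal; simpl; unfold mult; simpl; field; lra.
    - unfold scal, minus, plus, opp; simpl; unfold mult; simpl; ring. }
  evar_last; [|exact E].
  apply (is_derive_RInt_strip a b 0 (2 * PI) p pr); auto; intros; now apply H1.
Qed.

(** * The Cauchy kernel of the periodic strip *)

(** This is [|r e^{it} - x|^2]. *)
Definition kden (x r t : R) : R := r ^ 2 - 2 * x * r * cos t + x ^ 2.
(* [poisson x r t - i poisson_conj x r t = coth ((ln (r / x) + i t) / 2)]. *)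
Definition poisson (x r t : R) : R := (r ^ 2 - x ^ 2) / kden x r t.
Definition poisson_conj (x r t : R) : R := 2 * x * r * sin t / kden x r t.

Lemma cos_2PI_shift (t : R) : cos (t + 2 * PI) = cos t.
Proof. rewrite <- (cos_period t 1); f_equal; simpl; ring. Qed.

Lemma sin_2PI_shift (t : R) : sin (t + 2 * PI) = sin t.
Proof. rewrite <- (sin_period t 1); f_equal; simpl; ring. Qed.

Lemma cos_le_1 (t : R) : cos t <= 1.
Proof. apply COS_bound. Qed.

Lemma kden_pos (x r t : R) : 0 < x -> 0 < r -> r <> x -> 0 < kden x r t.
Proof.
  intros Hx Hr H; unfold kden.
  pose proof (cos_le_1 t).
  assert (0 < (r - x) ^ 2) by (apply pow2_gt_0; lra).
  assert (0 <= x * r * (1 - cos t)).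
  { apply Rmult_le_pos; [|lra]. apply Rmult_le_pos; lra. }
  nra.
Qed.

Definition poisson_r (x r t : R) : R :=
  (2 * r * kden x r t - (r ^ 2 - x ^ 2) * (2 * r - 2 * x * cos t)) / kden x r t ^ 2.
Definition poisson_conj_r (x r t : R) : R :=
  (2 * x * sin t * kden x r t - 2 * x * r * sin t * (2 * r - 2 * x * cos t))
    / kden x r t ^ 2.

Lemma sin_sqr (t : R) : sin t * sin t = 1 - cos t * cos t.
Proof. pose proof (sin2_cos2 t); unfold Rsqr in *; lra. Qed.

Lemma continuity_2d_pt_cos_shift (y r t : R) :
  continuity_2d_pt (fun _ v => cos (v - y)) r t.
Proof.
  apply (continuity_1d_2d_pt_comp cos (fun _ v => v - y)); [apply continuity_cos|cont2d].
Qed.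

Lemma continuity_2d_pt_sin_shift (y r t : R) :
  continuity_2d_pt (fun _ v => sin (v - y)) r t.
Proof.
  apply (continuity_1d_2d_pt_comp sin (fun _ v => v - y)); [apply continuity_sin|cont2d].
Qed.

Lemma continuity_2d_pt_kden (x y r t : R) :
  continuity_2d_pt (fun r t => kden x r (t - y)) r t.
Proof.
  unfold kden.
  pose proof (continuity_2d_pt_cos_shift y r t).
  simpl; cont2d.
Qed.

(** The kernel with pole [(x, y)] is holomorphic as long as the circle [r = x] stays outside the
    strip [a < r < b]. *)
Lemma poisson_cr_pair (x y a b : R) :
  0 < x -> 0 <= a -> x <= a \/ b <= x ->
  cr_pair a b (fun r t => poisson x r (t - y))
    (fun r t => poisson_conj x r (t - y))
    (fun r t => poisson_r x r (t - y)) (fun r t => poisson_conj_r x r (t - y)).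
Proof.
  intros Hx Ha Hab.
  assert (K : C1_strip a b (fun r t => poisson x r (t - y)) (fun r t => poisson_r x r (t - y))
      (fun r t => r * poisson_conj_r x r (t - y)) /\
    C1_strip a b (fun r t => poisson_conj x r (t - y)) (fun r t => poisson_conj_r x r (t - y))
      (fun r t => - (r * poisson_r x r (t - y)))).
  { split; intros r t Hr.
    all: assert (HD : 0 < kden x r (t - y)) by (apply kden_pos; lra).
    all: pose proof (continuity_2d_pt_kden x y r t) as CD.
    all: pose proof (continuity_2d_pt_cos_shift y r t) as CC.
    all: pose proof (continuity_2d_pt_sin_shift y r t) as CS.
    all: assert (CI : continuity_2d_pt (fun r t => / kden x r (t - y)) r t)
      by (apply (continuity_2d_pt_inv (fun r t => kden x r (t - y))); [exact CD|lra]).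
    all: assert (CI2 : continuity_2d_pt (fun r t => / kden x r (t - y) ^ 2) r t)
      by (apply (continuity_2d_pt_inv (fun r t => kden x r (t - y) ^ 2));
          [simpl; cont2d|simpl; nra]).
    all: split; [|split; [|split; [|split]]].
    all: try (unfold poisson, poisson_r, poisson_conj, poisson_conj_r, Rdiv;
      simpl in *; cont2d; fail).
    (* Side conditions come back with the denominator in expanded form; identifying it with [kden]
       shows that it is not 0. *)
    all: assert (HD' : forall z, z = kden x r (t - y) -> z <> 0) by (intros; lra).
    all: pose proof (sin_sqr (t - y)) as S.
    all: unfold poisson, poisson_r, poisson_conj, poisson_conj_r, kden in *.
    all: auto_derive; [apply HD'; simpl; ring_simplify; repeat f_equal; ring|].
    all: replace (t + - y) with (t - y) in * by ring; simpl in *;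
      set (c := cos (t - y)) in *; set (s := sin (t - y)) in *.
    all: field_simplify_eq; [|apply HD'; simpl; ring].
    (* With denominators cleared, the derivative formulas are polynomial identities modulo
       [s^2 + c^2 = 1]. *)
    all: replace (s ^ 2) with (1 - c ^ 2) by (simpl; lra); ring. }
  split; [|split; [|split]].
  - intros r t Hr; now apply K.
  - intros r t Hr; now apply K.
  - intros r t Hr; unfold poisson, kden.
    replace (t + 2 * PI - y) with (t - y + 2 * PI) by ring; now rewrite cos_2PI_shift.
  - intros r t Hr; unfold poisson_conj, kden.
    replace (t + 2 * PI - y) with (t - y + 2 * PI) by ring.
    now rewrite cos_2PI_shift, sin_2PI_shift.
Qed.

Lemma RInt_periodic_shift (f : R -> R) (T y : R) :
  (forall t, continuous f t) -> (forall t, f (t + T) = f t) ->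
  RInt (fun t => f (t - y)) 0 T = RInt f 0 T.
Proof.
  intros Hc Hp.
  rewrite <- (RInt_periodic f T (- y) Hc Hp).
  pose proof (RInt_comp_lin f 1 (- y) 0 T) as H.
  replace (1 * 0 + - y) with (- y) in H by ring.
  replace (1 * T + - y) with (- y + T) in H by ring.
  rewrite <- H by now apply continuous_ex_RInt.
  apply RInt_ext; intros t _.
  unfold scal; simpl; unfold mult; simpl.
  rewrite !Rmult_1_l; f_equal; ring.
Qed.

Lemma poisson_pos (x r t : R) : 0 < x < r -> 0 < poisson x r t.
Proof.
  intros H; apply Rdiv_lt_0_compat; [nra|apply kden_pos; lra].
Qed.

(** The kernel depends only on [r / x] and the angle, so that [r -> x] becomes [l -> 1] with a
    kernel free of [x]. *)
Lemma poisson_mul (x l t : R) : 0 < x -> 1 < l -> poisson x (x * l) t = poisson 1 l t.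
Proof.
  intros Hx Hl; unfold poisson.
  replace (kden x (x * l) t) with (x ^ 2 * kden 1 l t) by (unfold kden; ring).
  pose proof (kden_pos 1 l t ltac:(lra) ltac:(lra) ltac:(lra)).
  field; lra.
Qed.

Lemma poisson_conj_mul (x l t : R) :
  0 < x -> 1 < l -> poisson_conj x (x * l) t = poisson_conj 1 l t.
Proof.
  intros Hx Hl; unfold poisson_conj.
  replace (kden x (x * l) t) with (x ^ 2 * kden 1 l t) by (unfold kden; ring).
  pose proof (kden_pos 1 l t ltac:(lra) ltac:(lra) ltac:(lra)).
  field; lra.
Qed.

Lemma kden_div (x l t : R) : 0 < l -> kden x (x / l) t = x ^ 2 / l ^ 2 * kden 1 l t.
Proof. intros; unfold kden; field; lra. Qed.

(** The reflection [r -> x^2 / r] replaces [w] by minus its conjugate in [coth (w / 2)]: the real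
    part changes sign, the imaginary part stays. *)
Lemma poisson_div (x l t : R) :
  0 < x -> 1 < l -> poisson x (x / l) t = - poisson 1 l t.
Proof.
  intros Hx Hl; unfold poisson; rewrite kden_div by lra.
  pose proof (kden_pos 1 l t ltac:(lra) ltac:(lra) ltac:(lra)).
  field; lra.
Qed.

Lemma poisson_conj_div (x l t : R) :
  0 < x -> 1 < l -> poisson_conj x (x / l) t = poisson_conj 1 l t.
Proof.
  intros Hx Hl; unfold poisson_conj; rewrite kden_div by lra.
  pose proof (kden_pos 1 l t ltac:(lra) ltac:(lra) ltac:(lra)).
  field; lra.
Qed.

Lemma continuous_poisson (x r t : R) :
  0 < x -> 0 < r -> r <> x -> continuous (poisson x r) t.
Proof.
  intros; pose proof (kden_pos x r t ltac:(lra) ltac:(lra) ltac:(lra)).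
  apply (ex_derive_continuous (poisson x r)); unfold poisson, kden in *; auto_derive.
  simpl in *; lra.
Qed.

Lemma continuous_poisson_conj (x r t : R) :
  0 < x -> 0 < r -> r <> x -> continuous (poisson_conj x r) t.
Proof.
  intros; pose proof (kden_pos x r t ltac:(lra) ltac:(lra) ltac:(lra)).
  apply (ex_derive_continuous (poisson_conj x r)); unfold poisson_conj, kden in *; auto_derive.
  simpl in *; lra.
Qed.

Lemma poisson_periodic (x r t : R) : poisson x r (t + 2 * PI) = poisson x r t.
Proof. unfold poisson, kden; now rewrite cos_2PI_shift. Qed.

Lemma poisson_conj_periodic (x r t : R) :
  poisson_conj x r (t + 2 * PI) = poisson_conj x r t.
Proof. unfold poisson_conj, kden; now rewrite cos_2PI_shift, sin_2PI_shift. Qed.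

(* Its value is [2 PI], but only its positivity is needed. *)
Definition poisson_mass : R := RInt (poisson 1 2) 0 (2 * PI).

Lemma poisson_mass_pos : 0 < poisson_mass.
Proof.
  apply RInt_gt_0.
  - pose proof PI_RGT_0; lra.
  - intros; apply poisson_pos; lra.
  - intros; apply continuous_poisson; lra.
Qed.

(** Cauchy's theorem for the kernel itself outside its pole circle; [Rmax l 2 + 1] is a radius
    beyond both [l] and 2. *)
Lemma RInt_poisson (l : R) : 1 < l -> RInt (poisson 1 l) 0 (2 * PI) = poisson_mass.
Proof.
  intros Hl.
  pose proof (Rmax_l l 2); pose proof (Rmax_r l 2).
  pose proof (poisson_cr_pair 1 0 1 (Rmax l 2 + 1) ltac:(lra) ltac:(lra) ltac:(lra)) as H1.
  pose proof (cr_pair_mean_const 1 (Rmax l 2 + 1) _ _ _ _ ltac:(lra) H1 l 2 ltac:(lra) ltac:(lra)) as E.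
  unfold poisson_mass; etransitivity; [|etransitivity; [exact E|]].
  - apply RInt_ext; intros; now rewrite Rminus_0_r.
  - apply RInt_ext; intros; now rewrite Rminus_0_r.
Qed.

(** * Jump of the Cauchy integral across the circle of its pole *)

(** An error [C (1 - cos s)] is as good as a small one: its product with the Poisson kernel tends to
    0 uniformly as [l -> 1], by [poisson_weight]. *)
Lemma near_bound (a b x y : R) (f : R -> R -> R) :
  a < x < b -> (forall r t, a < r < b -> continuity_2d_pt f r t) ->
  forall eps, 0 < eps -> exists d C, 0 < d /\ 0 <= C /\
    forall r s, Rabs (r - x) < d -> Rabs s <= PI ->
      Rabs (f r (y + s) - f x y) <= eps + C * (1 - cos s).
Proof.
  intros Hx Hf eps Heps.
  pose proof PI_RGT_0 as HPI.
  set (eta := Rmin (x - a) (b - x) / 2).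
  assert (Heta : 0 < eta /\ a < x - eta /\ x + eta < b).
  { pose proof (Rmin_glb_lt (x - a) (b - x) 0 ltac:(lra) ltac:(lra)).
    pose proof (Rmin_l (x - a) (b - x)); pose proof (Rmin_r (x - a) (b - x)).
    unfold eta; lra. }
  destruct (uniform_continuity_2d f (x - eta) (x + eta) (y - PI) (y + PI)) with (mkposreal _ Heps)
    as [d Hd]; [intros; apply Hf; lra|]; simpl in Hd.
  destruct (continuity_ab_maj (fun t => Rabs (f x t - f x y)) (y - PI) (y + PI))
    as [m [Hm _]]; [lra| |].
  { intros c _.
    apply continuity_pt_filterlim.
    apply (continuous_comp (fun t => f x t - f x y) Rabs); [|apply continuous_Rabs].
    apply (continuous_minus (V := R_NormedModule) (f x)); [|apply continuous_const].
    now apply continuity_2d_pt_snd, Hf. }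
  set (M := Rabs (f x m - f x y)) in *.
  set (d' := Rmin d PI).
  assert (Hd' : 0 < d' /\ d' <= d /\ d' <= PI).
  { pose proof (cond_pos d); unfold d'; split; [apply Rmin_glb_lt; lra|].
    split; [apply Rmin_l|apply Rmin_r]. }
  assert (Hc : 0 < 1 - cos d').
  { pose proof (cos_decreasing_1 0 d'); rewrite cos_0 in *; lra. }
  assert (HM : 0 <= M) by apply Rabs_pos.
  assert (HC : 0 <= M / (1 - cos d')) by (apply Rdiv_le_0_compat; lra).
  exists (Rmin d eta), (M / (1 - cos d')); split; [|split]; auto.
  { pose proof (cond_pos d); apply Rmin_glb_lt; lra. }
  intros r s Hr Hs.
  pose proof (Rmin_l d eta); pose proof (Rmin_r d eta).
  assert (Hr1 : Rabs (r - x) < d) by lra.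
  assert (Hr2 : Rabs (r - x) < eta) by lra.
  apply Rabs_def2 in Hr2.
  assert (Hs' := Hs); apply Rabs_le_between in Hs'.
  pose proof (cos_le_1 s).
  (* Close to [y] uniform continuity suffices. Farther away the oscillation, at most [M] on the
     circle [r = x], is absorbed by [C (1 - cos s)], since there [1 - cos s >= 1 - cos d']. *)
  destruct (Rlt_or_le (Rabs s) d') as [Hsd|Hsd].
  - assert (Rabs (f r (y + s) - f x y) < eps).
    { apply Hd; try lra. replace (y + s - y) with s by ring; lra. }
    assert (0 <= M / (1 - cos d') * (1 - cos s)) by (apply Rmult_le_pos; lra).
    lra.
  - assert (Rabs (f r (y + s) - f x (y + s)) < eps).
    { apply Hd; try lra. rewrite Rminus_eq_0, Rabs_R0; apply cond_pos. }
    assert (Rabs (f x (y + s) - f x y) <= M) by (apply Hm; lra).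
    assert (M <= M / (1 - cos d') * (1 - cos s)).
    { replace M with (M / (1 - cos d') * (1 - cos d')) at 1 by (field; lra).
      apply Rmult_le_compat_l; auto.
      assert (cos (Rabs s) <= cos d').
      { destruct (Req_dec d' (Rabs s)) as [->|Hne]; [lra|].
        apply Rlt_le, cos_decreasing_1; lra. }
      assert (cos (Rabs s) = cos s) as <-; [|lra].
      unfold Rabs; destruct Rcase_abs; [apply cos_neg|reflexivity]. }
    pose proof (Rabs_triang (f r (y + s) - f x (y + s)) (f x (y + s) - f x y)) as T.
    replace (f r (y + s) - f x (y + s) + (f x (y + s) - f x y))
      with (f r (y + s) - f x y) in T by ring.
    lra.
Qed.

(** Mean value theorem in [r], with [fr] bounded through [near_bound]. Applied to [q], it
    compensates the factor [1 / (l^2 - 1)] in the quotient of [poisson_conj] by [poisson]. *)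
Lemma near_lipschitz (a b x y : R) (f fr : R -> R -> R) :
  a < x < b ->
  (forall r t, a < r < b -> is_derive (fun s => f s t) r (fr r t)) ->
  (forall r t, a < r < b -> continuity_2d_pt fr r t) ->
  exists d M, 0 < d /\ 0 <= M /\
    forall r r' s, Rabs (r - x) < d -> Rabs (r' - x) < d -> Rabs s <= PI ->
      Rabs (f r (y + s) - f r' (y + s)) <= M * Rabs (r - r').
Proof.
  intros Hx Hd Hfr.
  destruct (near_bound a b x y fr Hx Hfr 1 Rlt_0_1) as (d & C & Hd0 & HC & HB).
  (* The bound is that of [near_bound] with error 1, combined with [1 - cos s <= 2]. *)
  exists (Rmin d (Rmin (x - a) (b - x))), (Rabs (fr x y) + 1 + C * 2).
  split; [|split].
  - repeat apply Rmin_glb_lt; lra.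
  - pose proof (Rabs_pos (fr x y)); nra.
  - intros r r' s Hr Hr' Hs.
    pose proof (Rmin_l d (Rmin (x - a) (b - x))) as m1.
    pose proof (Rmin_r d (Rmin (x - a) (b - x))) as m2.
    pose proof (Rmin_l (x - a) (b - x)) as m3; pose proof (Rmin_r (x - a) (b - x)) as m4.
    set (m := Rmin d (Rmin (x - a) (b - x))) in *; set (m' := Rmin (x - a) (b - x)) in *.
    apply Rabs_def2 in Hr; apply Rabs_def2 in Hr'.
    destruct (MVT_gen (fun z => f z (y + s)) r' r (fun z => fr z (y + s))) as [c [Hc Ec]].
    + intros z Hz; apply Hd.
      revert Hz; unfold Rmin, Rmax; destruct Rle_dec; lra.
    + intros z Hz.
      assert (Hz' : a < z < b) by (revert Hz; unfold Rmin, Rmax; destruct Rle_dec; lra).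
      apply continuity_pt_filterlim, (ex_derive_continuous (fun z => f z (y + s))).
      eexists; apply Hd, Hz'.
    + simpl in Ec; rewrite Ec, Rabs_mult.
      apply Rmult_le_compat_r; [apply Rabs_pos|].
      assert (Hc' : Rabs (c - x) < d).
      { apply Rabs_def1; revert Hc; unfold Rmin, Rmax; destruct Rle_dec; lra. }
      specialize (HB c s Hc' Hs).
      pose proof (Rabs_triang (fr c (y + s) - fr x y) (fr x y)) as T.
      replace (fr c (y + s) - fr x y + fr x y) with (fr c (y + s)) in T by ring.
      pose proof (COS_bound s).
      assert (C * (1 - cos s) <= C * 2) by (apply Rmult_le_compat_l; lra).
      lra.
Qed.

(** Real part of the integral of [p - i q] times the kernel with pole [(x, y)], along the circle of
    radius [r]. *)
Definition cauchy_integral (p q : R -> R -> R) (x y r : R) : R :=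
  RInt (fun t => p r t * poisson x r (t - y) - q r t * poisson_conj x r (t - y))
    0 (2 * PI).

(** [kden 1 l s = (l - 1)^2 + 2 l (1 - cos s)]; dropping the square gives a bound that is uniform in
    [s] and tends to 0 as [l -> 1]. *)
Lemma poisson_weight (l s : R) :
  1 < l -> (1 - cos s) * poisson 1 l s <= (l ^ 2 - 1) / (2 * l).
Proof.
  intros Hl; unfold poisson.
  pose proof (kden_pos 1 l s ltac:(lra) ltac:(lra) ltac:(lra)) as HD.
  pose proof (cos_le_1 s).
  assert (K : (1 - cos s) * (2 * l) <= kden 1 l s).
  { unfold kden; pose proof (pow2_ge_0 (l - 1)); nra. }
  assert (0 < l ^ 2 - 1) by nra.
  replace ((1 - cos s) * ((l ^ 2 - 1 ^ 2) / kden 1 l s))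
    with ((l ^ 2 - 1) / (2 * l) * ((1 - cos s) * (2 * l) / kden 1 l s)) by (field; lra).
  rewrite <- (Rmult_1_r ((l ^ 2 - 1) / (2 * l))) at 2.
  apply Rmult_le_compat_l; [apply Rdiv_le_0_compat; lra|].
  apply Rle_div_l; lra.
Qed.

(** Difference of the integrands on the circles [x l] and [x / l], compared with [2 p x y] times the
    kernel: by reflection the values of [p] add up, and those of [q] subtract to [O(l - 1)]. *)
Lemma jump_pointwise (a b x y : R) (p q pr qr : R -> R -> R) :
  0 < x -> a < x < b -> cr_pair a b p q pr qr ->
  forall eps, 0 < eps -> exists d C, 0 < d /\ 0 <= C /\
    forall l s, 1 < l < 1 + d -> Rabs s <= PI ->
      Rabs ((p (x * l) (y + s) + p (x / l) (y + s) - 2 * p x y) * poisson 1 l s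
            - (q (x * l) (y + s) - q (x / l) (y + s)) * poisson_conj 1 l s)
      <= (eps + C * (1 - cos s)) * poisson 1 l s.
Proof.
  intros Hx0 Hx (H1 & H2 & _ & _) eps Heps.
  destruct (near_bound a b x y p Hx ltac:(intros; now apply H1) (eps / 4) ltac:(lra))
    as (d1 & C1 & Hd1 & HC1 & B1).
  destruct (near_lipschitz a b x y q qr Hx ltac:(intros; now apply H2)
    ltac:(intros; now apply H2)) as (d2 & M & Hd2 & HM & B2).
  (* [M (x l - x / l)] times [2 l / (l^2 - 1)] is exactly [2 M x], whatever [l]. *)
  set (A := 2 * M * x).
  assert (HA : 0 <= A) by (unfold A; nra).
  assert (HA2 : 0 <= A ^ 2 / eps) by (apply Rdiv_le_0_compat; [apply pow2_ge_0|lra]).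
  (* The two values of [p] account for [eps / 2] and [2 C1], the [q] term for the rest; the choice
     of [d] keeps [x l] and [x / l] within reach of both local bounds. *)
  exists (Rmin d1 d2 / x), (2 * C1 + A ^ 2 / eps).
  assert (Hm : 0 < Rmin d1 d2) by (apply Rmin_glb_lt; lra).
  split; [|split]; [now apply Rdiv_lt_0_compat|lra|].
  intros l s [Hl Hld] Hs.
  assert (Hxl : x * (l - 1) < Rmin d1 d2).
  { replace (Rmin d1 d2) with (x * (Rmin d1 d2 / x)) by (field; lra).
    apply Rmult_lt_compat_l; lra. }
  pose proof (Rmin_l d1 d2); pose proof (Rmin_r d1 d2).
  assert (Hup : Rabs (x * l - x) < Rmin d1 d2).
  { rewrite Rabs_pos_eq; nra. }
  assert (Hdiv : x - x * (l - 1) <= x / l <= x).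
  { split; [apply Rle_div_r; [lra|] | apply Rle_div_l; [lra|nra]].
    pose proof (pow2_ge_0 (l - 1)); nra. }
  assert (Hdn : Rabs (x / l - x) < Rmin d1 d2).
  { apply Rabs_def1; nra. }
  pose proof (B1 (x * l) s ltac:(lra) Hs) as b1.
  pose proof (B1 (x / l) s ltac:(lra) Hs) as b2.
  pose proof (B2 (x * l) (x / l) s ltac:(lra) ltac:(lra) Hs) as b3.
  assert (HP : 0 < poisson 1 l s) by (apply poisson_pos; lra).
  pose proof (kden_pos 1 l s ltac:(lra) ltac:(lra) ltac:(lra)) as HD.
  assert (Hl2 : 0 < l ^ 2 - 1) by nra.
  pose proof (cos_le_1 s) as Hcos.
  replace (poisson_conj 1 l s) with (2 * l * sin s / (l ^ 2 - 1) * poisson 1 l s)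
    by (unfold poisson, poisson_conj; field; lra).
  rewrite <- Rmult_assoc, <- Rmult_minus_distr_r, Rabs_mult, (Rabs_pos_eq (poisson 1 l s)) by lra.
  apply Rmult_le_compat_r; [lra|].
  set (dq := q (x * l) (y + s) - q (x / l) (y + s)) in *.
  assert (Q1 : Rabs (dq * (2 * l * sin s / (l ^ 2 - 1))) <= A * Rabs (sin s)).
  { rewrite Rabs_mult.
    replace (2 * l * sin s / (l ^ 2 - 1)) with (2 * l / (l ^ 2 - 1) * sin s) by (field; lra).
    rewrite Rabs_mult, (Rabs_pos_eq (2 * l / (l ^ 2 - 1))) by (apply Rdiv_le_0_compat; lra).
    rewrite <- Rmult_assoc; apply Rmult_le_compat_r; [apply Rabs_pos|].
    replace A with (M * Rabs (x * l - x / l) * (2 * l / (l ^ 2 - 1))).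
    - apply Rmult_le_compat_r; [apply Rdiv_le_0_compat; lra|exact b3].
    - rewrite Rabs_pos_eq by nra; unfold A; field; lra. }
  (* AM-GM: [A |sin s| <= eps / 2 + A^2 sin^2 s / (2 eps)]. *)
  assert (Q2 : A * Rabs (sin s) <= eps / 2 + A ^ 2 / eps * (1 - cos s)).
  { assert (S : Rabs (sin s) ^ 2 <= 2 * (1 - cos s)).
    { rewrite pow2_abs; pose proof (sin_sqr s); pose proof (COS_bound s); nra. }
    assert (E : A * Rabs (sin s) <= eps / 2 + A ^ 2 / eps * (Rabs (sin s) ^ 2 / 2)).
    { apply (Rmult_le_reg_l (2 * eps)); [lra|].
      replace (2 * eps * (eps / 2 + A ^ 2 / eps * (Rabs (sin s) ^ 2 / 2)))
        with (eps ^ 2 + (A * Rabs (sin s)) ^ 2) by (field; lra).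
      pose proof (pow2_ge_0 (eps - A * Rabs (sin s))); nra. }
    assert (A ^ 2 / eps * (Rabs (sin s) ^ 2 / 2) <= A ^ 2 / eps * (1 - cos s))
      by (apply Rmult_le_compat_l; lra).
    lra. }
  apply Rabs_le_between in b1; apply Rabs_le_between in b2.
  apply Rabs_le_between in Q1; apply Rabs_le_between; split; nra.
Qed.

(** Puts the angle of the pole at the centre of the period, where the local estimates with
    [|s| <= PI] apply. *)
Lemma RInt_periodic_center (h : R -> R) (y : R) :
  (forall t, continuous h t) -> (forall t, h (t + 2 * PI) = h t) ->
  RInt h 0 (2 * PI) = RInt (fun s => h (y + s)) (- PI) PI.
Proof.
  intros Hc Hp.
  rewrite <- (RInt_periodic_shift h (2 * PI) (- y) Hc Hp).
  rewrite <- (RInt_periodic (fun t => h (t - - y)) (2 * PI) (- PI)).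
  - replace (- PI + 2 * PI) with PI by ring.
    apply RInt_ext; intros; f_equal; ring.
  - intros t.
    apply (continuous_comp (fun t => t - - y) h); [|apply Hc].
    apply (ex_derive_continuous (fun t => t - - y)); auto_derive; auto.
  - intros t; rewrite <- (Hp (t - - y)); f_equal; ring.
Qed.

Lemma cauchy_integrand_continuous (p q : R -> R -> R) (x y r t : R) :
  0 < x -> 0 < r -> r <> x -> continuous (p r) t -> continuous (q r) t ->
  continuous (fun t => p r t * poisson x r (t - y) - q r t * poisson_conj x r (t - y)) t.
Proof.
  intros Hx Hr Hne Hp Hq.
  assert (S : continuous (fun t => t - y) t)
    by (apply (ex_derive_continuous (fun t => t - y)); auto_derive; auto).
  apply (continuous_minus (V := R_NormedModule)
    (fun t => p r t * poisson x r (t - y)) (fun t => q r t * poisson_conj x r (t - y))).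
  - apply (continuous_mult (K := R_AbsRing) (p r)); auto.
    apply (continuous_comp (fun t => t - y) (poisson x r)); auto.
    now apply continuous_poisson.
  - apply (continuous_mult (K := R_AbsRing) (q r)); auto.
    apply (continuous_comp (fun t => t - y) (poisson_conj x r)); auto.
    now apply continuous_poisson_conj.
Qed.

Lemma cauchy_integral_center (a b x y r : R) (p q pr qr : R -> R -> R) :
  0 < x -> 0 < r -> r <> x -> a < r < b -> cr_pair a b p q pr qr ->
  is_RInt (fun s => p r (y + s) * poisson x r s - q r (y + s) * poisson_conj x r s)
    (- PI) PI (cauchy_integral p q x y r).
Proof.
  intros Hx Hr Hne Hrb (H1 & H2 & H3 & H4).
  set (h := fun t => p r t * poisson x r (t - y) - q r t * poisson_conj x r (t - y)).
  assert (Hc : forall t, continuous h t).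
  { intros t; apply cauchy_integrand_continuous; auto;
      apply continuity_2d_pt_snd; [now apply H1|now apply H2]. }
  assert (Hp : forall t, h (t + 2 * PI) = h t).
  { intros t; unfold h; rewrite H3, H4 by lra.
    replace (t + 2 * PI - y) with (t - y + 2 * PI) by ring.
    now rewrite poisson_periodic, poisson_conj_periodic. }
  unfold cauchy_integral; fold h.
  rewrite (RInt_periodic_center h y Hc Hp).
  eapply is_RInt_ext; [|apply (RInt_correct (V := R_CompleteNormedModule) (fun s => h (y + s)))].
  - intros s _; unfold h; simpl; replace (y + s - y) with s by ring; reflexivity.
  - apply continuous_ex_RInt; intros t.
    apply (continuous_comp (fun t => y + t) h); [|apply Hc].
    apply (ex_derive_continuous (fun t => y + t)); auto_derive; auto.
Qed.

(** Cauchy's theorem for the product of the pair with the kernel, in a strip that avoids the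
    pole. *)
Lemma cauchy_integral_const (a b x y : R) (p q pr qr : R -> R -> R) :
  0 < x -> 0 <= a -> x <= a \/ b <= x -> cr_pair a b p q pr qr ->
  forall r r', a < r < b -> a < r' < b ->
    cauchy_integral p q x y r = cauchy_integral p q x y r'.
Proof.
  intros Hx Ha Hab H r r' Hr Hr'.
  exact (cr_pair_mean_const a b _ _ _ _ Ha
    (cr_pair_mult _ _ _ _ _ _ _ _ _ _ H (poisson_cr_pair x y a b Hx Ha Hab)) r r' Hr Hr').
Qed.

(** [jump_pointwise] over a period: the [eps] part is weighted by the mass of the kernel, the
    [1 - cos s] part by the uniform bound [poisson_weight]. *)
Lemma jump_integral (a b x y : R) (p q pr qr : R -> R -> R) :
  0 <= a -> a < x < b -> cr_pair a b p q pr qr ->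
  forall eps, 0 < eps -> exists d C, 0 < d /\ 0 <= C /\
    forall l, 1 < l < 1 + d -> a < x / l -> x * l < b ->
      Rabs (cauchy_integral p q x y (x * l) - cauchy_integral p q x y (x / l)
            - 2 * p x y * poisson_mass)
      <= eps * poisson_mass + C * ((l ^ 2 - 1) / (2 * l)) * (2 * PI).
Proof.
  intros Ha Hx H eps Heps.
  destruct (jump_pointwise a b x y p q pr qr ltac:(lra) Hx H eps Heps)
    as (d & C & Hd & HC & HB).
  exists d, C; split; [|split]; auto.
  intros l Hl Hal Hbl.
  assert (Hxl : x < x * l) by nra.
  assert (Hxl' : x / l < x) by (apply Rlt_div_l; nra).
  assert (Hup := cauchy_integral_center a b x y (x * l) p q pr qr
    ltac:(lra) ltac:(lra) ltac:(lra) ltac:(lra) H).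
  assert (Hdn := cauchy_integral_center a b x y (x / l) p q pr qr
    ltac:(lra) ltac:(lra) ltac:(lra) ltac:(lra) H).
  assert (HP : is_RInt (poisson 1 l) (- PI) PI poisson_mass).
  { rewrite <- (RInt_poisson l) by lra.
    rewrite (RInt_periodic_center (poisson 1 l) 0).
    - eapply is_RInt_ext; [|apply (RInt_correct (V := R_CompleteNormedModule)
        (fun s => poisson 1 l (0 + s)))].
      + intros; simpl; now rewrite Rplus_0_l.
      + apply continuous_ex_RInt; intros t.
        apply (continuous_comp (fun t => 0 + t) (poisson 1 l));
          [|apply continuous_poisson; lra].
        apply (ex_derive_continuous (fun t => 0 + t)); auto_derive; auto.
    - intros; apply continuous_poisson; lra.
    - intros; apply poisson_periodic. }
  refine (norm_RInt_le (V := R_NormedModule)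
    (fun s => (p (x * l) (y + s) + p (x / l) (y + s) - 2 * p x y) * poisson 1 l s
            - (q (x * l) (y + s) - q (x / l) (y + s)) * poisson_conj 1 l s)
    (fun s => eps * poisson 1 l s + C * ((l ^ 2 - 1) / (2 * l))) (- PI) PI _ _ _ _ _ _).
  - pose proof PI_RGT_0; lra.
  - intros s Hs; etransitivity; [apply HB; [lra|apply Rabs_le_between; lra]|].
    pose proof (poisson_weight l s ltac:(lra)).
    rewrite Rmult_plus_distr_r, Rmult_assoc.
    apply Rplus_le_compat_l, Rmult_le_compat_l; auto.
  - pose proof (is_RInt_minus _ _ _ _ _ _ (is_RInt_minus _ _ _ _ _ _ Hup Hdn)
      (is_RInt_scal _ _ _ (2 * p x y) _ HP)) as I.
    eapply is_RInt_ext; [|exact I].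
    intros s _; unfold minus, plus, opp, scal; simpl; unfold mult; simpl.
    rewrite poisson_mul, poisson_conj_mul, poisson_div, poisson_conj_div by lra; ring.
  - pose proof (is_RInt_plus _ _ _ _ _ _ (is_RInt_scal _ _ _ eps _ HP)
      (is_RInt_const (- PI) PI (C * ((l ^ 2 - 1) / (2 * l))))) as I.
    evar_last; [exact I|].
    unfold plus, scal; simpl; unfold mult; simpl; ring.
Qed.

(** The integral is independent of the radius on either side of [r = x], so [rb] and [ra] may be
    replaced by [x l] and [x / l] with [l] arbitrarily close to 1; only the jump remains. *)
Lemma cauchy_integral_formula (a b x y ra rb : R) (p q pr qr : R -> R -> R) :
  0 <= a -> a < x < b -> a < ra < x -> x < rb < b -> cr_pair a b p q pr qr ->
  cauchy_integral p q x y rb - cauchy_integral p q x y ra = 2 * poisson_mass * p x y.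
Proof.
  intros Ha Hx Hra Hrb H.
  set (L := cauchy_integral p q x y rb - cauchy_integral p q x y ra).
  pose proof poisson_mass_pos as Hk.
  assert (forall e, 0 < e -> Rabs (L - 2 * p x y * poisson_mass) <= e * (poisson_mass + 2 * PI)).
  { intros e He.
    destruct (jump_integral a b x y p q pr qr Ha Hx H e He) as (d & C & Hd & HC & HB).
    pose proof PI_RGT_0.
    (* With [l = 1 + m], the first bound admits [jump_integral], the second makes
       [C (l^2 - 1) / (2 l)] at most [e], and the last two keep both circles in the strip. *)
    set (m := Rmin (Rmin d (e / (C + 1))) (Rmin ((x - a) / x) ((b - x) / x)) / 2).
    assert (Hm : 0 < m /\ m < d /\ m < e / (C + 1) /\ m < (x - a) / x /\ m < (b - x) / x).
    { assert (0 < Rmin (Rmin d (e / (C + 1))) (Rmin ((x - a) / x) ((b - x) / x))).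
      { repeat apply Rmin_glb_lt; try lra; apply Rdiv_lt_0_compat; lra. }
      pose proof (Rmin_l (Rmin d (e / (C + 1))) (Rmin ((x - a) / x) ((b - x) / x))).
      pose proof (Rmin_r (Rmin d (e / (C + 1))) (Rmin ((x - a) / x) ((b - x) / x))).
      pose proof (Rmin_l d (e / (C + 1))); pose proof (Rmin_r d (e / (C + 1))).
      pose proof (Rmin_l ((x - a) / x) ((b - x) / x)).
      pose proof (Rmin_r ((x - a) / x) ((b - x) / x)).
      unfold m; lra. }
    destruct Hm as (m0 & m1 & m2 & m3 & m4).
    apply Rlt_div_r in m2; [|lra]; apply Rlt_div_r in m3; [|lra]; apply Rlt_div_r in m4; [|lra].
    set (l := 1 + m).
    assert (Hal : a < x / l) by (apply Rlt_div_r; unfold l; nra).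
    assert (Hbl : x * l < b) by (unfold l; nra).
    assert (Hxl : x < x * l) by (unfold l; nra).
    assert (Hxl' : x / l < x) by (apply Rlt_div_l; unfold l; nra).
    specialize (HB l ltac:(unfold l; lra) Hal Hbl).
    rewrite (cauchy_integral_const x b x y p q pr qr ltac:(lra) ltac:(lra) ltac:(lra)
      (cr_pair_sub a b x b _ _ _ _ ltac:(lra) ltac:(lra) H) (x * l) rb) in HB by lra.
    rewrite (cauchy_integral_const a x x y p q pr qr ltac:(lra) ltac:(lra) ltac:(lra)
      (cr_pair_sub a b a x _ _ _ _ ltac:(lra) ltac:(lra) H) (x / l) ra) in HB by lra.
    fold L in HB; etransitivity; [exact HB|].
    assert (C * ((l ^ 2 - 1) / (2 * l)) <= e).
    { assert ((l ^ 2 - 1) / (2 * l) <= m).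
      { apply Rle_div_l; unfold l; nra. }
      nra. }
    nra. }
  assert (L - 2 * p x y * poisson_mass = 0); [|lra].
  apply Rabs_eq_0, Rle_antisym; [|apply Rabs_pos].
  pose proof PI_RGT_0.
  apply Rnot_lt_le; intros Hlt.
  (* This value of [e] bounds a positive quantity by its own half. *)
  specialize (H0 (Rabs (L - 2 * p x y * poisson_mass) / (2 * (poisson_mass + 2 * PI)))).
  replace (Rabs (L - 2 * p x y * poisson_mass) / (2 * (poisson_mass + 2 * PI)) * (poisson_mass + 2 * PI))
    with (Rabs (L - 2 * p x y * poisson_mass) / 2) in H0 by (field; lra).
  assert (0 < Rabs (L - 2 * p x y * poisson_mass) / (2 * (poisson_mass + 2 * PI)))
    by (apply Rdiv_lt_0_compat; lra).
  specialize (H0 H2); lra.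
Qed.

(** * Smoothness *)

(* A class of functions of [(x, t)], containing both kernels for the fixed
   radius [c], that is closed under both partial derivatives; a syntax is used
   so that "all derivatives exist" becomes an induction. *)
Inductive kexp : Set :=
  | KConst (k : R) | KRad | KCos | KSin | KInvDen
  | KAdd (e1 e2 : kexp) | KMul (e1 e2 : kexp).

Fixpoint keval (c : R) (e : kexp) (x t : R) : R :=
  match e with
  | KConst k => k
  | KRad => x
  | KCos => cos t
  | KSin => sin t
  | KInvDen => / kden x c t
  | KAdd e1 e2 => keval c e1 x t + keval c e2 x t
  | KMul e1 e2 => keval c e1 x t * keval c e2 x t
  end.

Fixpoint kexp_x (c : R) (e : kexp) : kexp :=
  match e with
  | KConst _ | KCos | KSin => KConst 0
  | KRad => KConst 1
  | KInvDen => KMul (KMul KInvDen KInvDen)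
                 (KAdd (KMul (KConst (-2)) KRad) (KMul (KConst (2 * c)) KCos))
  | KAdd e1 e2 => KAdd (kexp_x c e1) (kexp_x c e2)
  | KMul e1 e2 => KAdd (KMul (kexp_x c e1) e2) (KMul e1 (kexp_x c e2))
  end.

Fixpoint kexp_t (c : R) (e : kexp) : kexp :=
  match e with
  | KConst _ | KRad => KConst 0
  | KCos => KMul (KConst (-1)) KSin
  | KSin => KCos
  | KInvDen => KMul (KMul KInvDen KInvDen)
                 (KMul (KConst (- 2 * c)) (KMul KRad KSin))
  | KAdd e1 e2 => KAdd (kexp_t c e1) (kexp_t c e2)
  | KMul e1 e2 => KAdd (KMul (kexp_t c e1) e2) (KMul e1 (kexp_t c e2))
  end.

Lemma keval_derive_x (c x t : R) (e : kexp) :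
  0 < c -> 0 < x -> x <> c ->
  is_derive (fun s => keval c e s t) x (keval c (kexp_x c e) x t).
Proof.
  intros Hc Hx Hne.
  induction e; simpl; try (auto_derive; [auto|ring]; fail).
  - pose proof (kden_pos x c t ltac:(lra) ltac:(lra) ltac:(lra)) as HD.
    unfold kden in *; simpl in HD |- *; auto_derive; [lra|field; lra].
  - eapply is_derive_Rplus; eauto.
  - eapply is_derive_Rmult; eauto.
Qed.

Lemma keval_derive_t (c x t : R) (e : kexp) :
  0 < c -> 0 < x -> x <> c ->
  is_derive (keval c e x) t (keval c (kexp_t c e) x t).
Proof.
  intros Hc Hx Hne.
  induction e; simpl; try (auto_derive; [auto|ring]; fail).
  - pose proof (kden_pos x c t ltac:(lra) ltac:(lra) ltac:(lra)) as HD.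
    unfold kden in *; simpl in HD |- *; auto_derive; [lra|field; lra].
  - eapply is_derive_Rplus; eauto.
  - eapply is_derive_Rmult; eauto.
Qed.

Lemma keval_continuous (c u v : R) (X T : R -> R -> R) (e : kexp) :
  0 < c -> 0 < X u v -> X u v <> c ->
  continuity_2d_pt X u v -> continuity_2d_pt T u v ->
  continuity_2d_pt (fun u v => keval c e (X u v) (T u v)) u v.
Proof.
  intros Hc Hx Hne HX HT.
  assert (HC : continuity_2d_pt (fun u v => cos (T u v)) u v)
    by (apply (continuity_1d_2d_pt_comp cos); [apply continuity_cos|exact HT]).
  assert (HS : continuity_2d_pt (fun u v => sin (T u v)) u v)
    by (apply (continuity_1d_2d_pt_comp sin); [apply continuity_sin|exact HT]).
  induction e; simpl; try now cont2d.
  pose proof (kden_pos (X u v) c (T u v) ltac:(lra) ltac:(lra) ltac:(lra)) as HD.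
  apply (continuity_2d_pt_inv (fun u v => kden (X u v) c (T u v))); [|lra].
  unfold kden; simpl; cont2d.
Qed.

Definition kernel_integral (c : R) (g : R -> R) (e : kexp) (x y : R) : R :=
  RInt (fun t => g t * keval c e x (t - y)) 0 (2 * PI).

Section KernelIntegral.

Variables (a b c : R) (g : R -> R).
Hypothesis Ha : 0 <= a.
Hypothesis Hc : 0 < c.
Hypothesis Hcab : c <= a \/ b <= c.
Hypothesis Hg : forall t, continuous g t.

Lemma continuity_2d_pt_density (u v : R) : continuity_2d_pt (fun _ t => g t) u v.
Proof.
  apply (continuity_1d_2d_pt_comp g (fun _ t => t)); [|cont2d].
  apply continuity_pt_filterlim, Hg.
Qed.

Lemma kernel_integral_derive_x (e : kexp) (x y : R) :
  a < x < b ->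
  is_derive (fun s => kernel_integral c g e s y) x (kernel_integral c g (kexp_x c e) x y).
Proof.
  apply (is_derive_RInt_strip a b 0 (2 * PI)
    (fun x t => g t * keval c e x (t - y)) (fun x t => g t * keval c (kexp_x c e) x (t - y)));
    intros r t Hr.
  - apply (is_derive_scal (fun s => keval c e s (t - y))), keval_derive_x; lra.
  - apply continuity_2d_pt_mult; [apply continuity_2d_pt_density|].
    apply (keval_continuous c r t (fun r _ => r) (fun _ t => t - y)); try lra; cont2d.
  - apply continuity_2d_pt_mult; [apply continuity_2d_pt_density|].
    apply (keval_continuous c r t (fun r _ => r) (fun _ t => t - y)); try lra; cont2d.
Qed.

Lemma kernel_integral_derive_y (e : kexp) (x y : R) :
  a < x < b ->
  is_derive (kernel_integral c g e x) y
    (kernel_integral c g (KMul (KConst (-1)) (kexp_t c e)) x y).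
Proof.
  intros Hx.
  apply (is_derive_RInt_strip (y - 1) (y + 1) 0 (2 * PI)
    (fun y t => g t * keval c e x (t - y))
    (fun y t => g t * keval c (KMul (KConst (-1)) (kexp_t c e)) x (t - y)));
    [intros r t Hr..|lra].
  - apply (is_derive_scal (fun s => keval c e x (t - s))).
    apply (is_derive_comp (keval c e x) (fun s => t - s)).
    + apply keval_derive_t; lra.
    + auto_derive; auto; ring.
  - apply continuity_2d_pt_mult; [apply continuity_2d_pt_density|].
    apply (keval_continuous c r t (fun _ _ => x) (fun r t => t - r)); try lra; cont2d.
  - apply continuity_2d_pt_mult; [apply continuity_2d_pt_density|].
    apply (keval_continuous c r t (fun _ _ => x) (fun r t => t - r)); try lra; cont2d.
Qed.

Lemma kernel_integral_continuous (e : kexp) (x y : R) :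
  a < x < b -> continuity_2d_pt (kernel_integral c g e) x y.
Proof.
  intros Hx eps.
  pose proof PI_RGT_0 as HPI.
  destruct (continuity_ab_maj (fun t => Rabs (g t)) 0 (2 * PI)) as [m [Hm _]]; [lra| |].
  { intros t _; apply continuity_pt_filterlim.
    apply (continuous_comp g Rabs); [apply Hg|apply continuous_Rabs]. }
  set (G := Rabs (g m) + 1) in *.
  assert (HG : 0 < G) by (unfold G; pose proof (Rabs_pos (g m)); lra).
  set (eta := Rmin (x - a) (b - x) / 2).
  assert (Heta : 0 < eta /\ a < x - eta /\ x + eta < b).
  { pose proof (Rmin_glb_lt (x - a) (b - x) 0 ltac:(lra) ltac:(lra)).
    pose proof (Rmin_l (x - a) (b - x)); pose proof (Rmin_r (x - a) (b - x)).
    unfold eta; lra. }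
  (* Multiplied by [G] and by the length [2 PI], this gives [eps / 2]. *)
  assert (He : 0 < eps / (4 * PI * G)).
  { pose proof (cond_pos eps); apply Rdiv_lt_0_compat; [lra|apply Rmult_lt_0_compat; lra]. }
  (* The second range contains every [t - v] with [t] in the period and [|v - y| < 1]. *)
  destruct (uniform_continuity_2d (keval c e) (x - eta) (x + eta) (- y - 1) (2 * PI - y + 1))
    with (mkposreal _ He) as [d Hd].
  { intros u v Hu _.
    apply (keval_continuous c u v (fun u _ => u) (fun _ v => v)); try lra; cont2d. }
  simpl in Hd.
  assert (Hm' : 0 < Rmin d (Rmin eta 1)).
  { pose proof (cond_pos d); repeat apply Rmin_glb_lt; lra. }
  exists (mkposreal _ Hm'); simpl; intros u v Hu Hv.
  pose proof (Rmin_l d (Rmin eta 1)); pose proof (Rmin_r d (Rmin eta 1)).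
  pose proof (Rmin_l eta 1); pose proof (Rmin_r eta 1).
  set (mm := Rmin d (Rmin eta 1)) in *; set (mm' := Rmin eta 1) in *.
  assert (I : forall x y, a < x < b ->
    is_RInt (fun t => g t * keval c e x (t - y)) 0 (2 * PI) (kernel_integral c g e x y)).
  { intros x' y' Hx'; apply (RInt_correct (V := R_CompleteNormedModule)), continuous_ex_RInt.
    intros t.
    apply (continuity_2d_pt_snd (fun x t => g t * keval c e x (t - y')) x' t).
    apply continuity_2d_pt_mult; [apply continuity_2d_pt_density|].
    apply (keval_continuous c x' t (fun r _ => r) (fun _ t => t - y')); try lra; cont2d. }
  assert (Hu' := Hu); apply Rabs_def2 in Hu'; assert (Hv' := Hv); apply Rabs_def2 in Hv'.
  pose proof (is_RInt_minus _ _ _ _ _ _ (I u v ltac:(lra)) (I x y Hx)) as D.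
  assert (B : forall t, Rmin 0 (2 * PI) <= t <= Rmax 0 (2 * PI) ->
    Rabs (g t * keval c e u (t - v) - g t * keval c e x (t - y)) <= eps / (4 * PI)).
  { intros t Ht; rewrite Rmin_left, Rmax_right in Ht by lra.
    rewrite <- Rmult_minus_distr_l, Rabs_mult.
    replace (eps / (4 * PI)) with (G * (eps / (4 * PI * G))) by (field; lra).
    apply Rmult_le_compat; try apply Rabs_pos.
    - unfold G; specialize (Hm t Ht); lra.
    - apply Rlt_le, Hd; try lra.
      replace (t - v - (t - y)) with (- (v - y)) by ring; rewrite Rabs_Ropp; lra. }
  apply (norm_RInt_le_const_abs (V := R_NormedModule) _ _ _ _ _ B) in D; rename D into B'.
  change (Rabs (kernel_integral c g e u v - kernel_integral c g e x y)
    <= Rabs (2 * PI - 0) * (eps / (4 * PI))) in B'.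
  rewrite (Rabs_pos_eq (2 * PI - 0)) in B' by lra.
  replace ((2 * PI - 0) * (eps / (4 * PI))) with (eps / 2) in B' by (field; lra).
  pose proof (cond_pos eps); lra.
Qed.

Lemma kernel_integral_smooth (n : nat) (e : kexp) (x y : R) :
  a < x < b -> ex_diff_n (kernel_integral c g e) n x y.
Proof.
  revert e x y; induction n as [|n IH]; intros e x y Hx.
  { split; [now apply kernel_integral_continuous|exact I]. }
  split; [now apply kernel_integral_continuous|].
  split; [eexists; now apply kernel_integral_derive_x|].
  split; [eexists; now apply kernel_integral_derive_y|].
  split.
  - apply (ex_diff_n_ext_loc (kernel_integral c g (kexp_x c e))); [|now apply IH].
    apply (locally_2d_strip a b); auto; intros s t Hs.
    symmetry; now apply is_derive_unique, kernel_integral_derive_x.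
  - apply (ex_diff_n_ext_loc (kernel_integral c g (KMul (KConst (-1)) (kexp_t c e))));
      [|now apply IH].
    apply (locally_2d_strip a b); auto; intros s t Hs.
    symmetry; now apply is_derive_unique, kernel_integral_derive_y.
Qed.

End KernelIntegral.

Lemma ex_diff_n_lin (a b k l : R) (n : nat) : forall f g : R -> R -> R,
  (forall x y, a < x < b -> ex_diff_n f n x y) ->
  (forall x y, a < x < b -> ex_diff_n g n x y) ->
  forall x y, a < x < b -> ex_diff_n (fun x y => k * f x y + l * g x y) n x y.
Proof.
  induction n as [|n IH]; intros f g Hf Hg x y Hx.
  { split; [|exact I].
    apply continuity_2d_pt_plus; apply continuity_2d_pt_mult; try cont2d;
      [now apply Hf|now apply Hg]. }
  assert (Ff : forall x y, a < x < b ->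
    ex_derive (fun z => f z y) x /\ ex_derive (f x) y /\
    ex_derive (fun z => g z y) x /\ ex_derive (g x) y).
  { intros u v Hu; destruct (Hf u v Hu) as (_ & A & B & _); destruct (Hg u v Hu) as (_ & A' & B' & _).
    auto. }
  assert (Dx : forall x y, a < x < b -> is_derive (fun z => k * f z y + l * g z y) x
    (k * Derive (fun z => f z y) x + l * Derive (fun z => g z y) x)).
  { intros u v Hu; destruct (Ff u v Hu) as (A & B & A' & B').
    apply (is_derive_Rplus (fun z => k * f z v) (fun z => l * g z v) u
      (k * Derive (fun z => f z v) u) (l * Derive (fun z => g z v) u)); auto;
      apply is_derive_scal; now apply Derive_correct. }
  assert (Dy : forall x y, a < x < b -> is_derive (fun z => k * f x z + l * g x z) y
    (k * Derive (fun z => f x z) y + l * Derive (fun z => g x z) y)).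
  { intros u v Hu; destruct (Ff u v Hu) as (A & B & A' & B').
    apply (is_derive_Rplus (fun z => k * f u z) (fun z => l * g u z) v
      (k * Derive (fun z => f u z) v) (l * Derive (fun z => g u z) v)); auto;
      apply is_derive_scal; now apply Derive_correct. }
  split; [|split; [|split; [|split]]].
  - apply continuity_2d_pt_plus; apply continuity_2d_pt_mult; try cont2d;
      [now apply Hf|now apply Hg].
  - eexists; now apply Dx.
  - eexists; now apply Dy.
  - eapply ex_diff_n_ext_loc; [|apply (IH (fun x y => Derive (fun z => f z y) x)
      (fun x y => Derive (fun z => g z y) x)); auto].
    + apply (locally_2d_strip a b); auto; intros u v Hu; symmetry; now apply is_derive_unique, Dx.
    + intros u v Hu; now apply Hf.
    + intros u v Hu; now apply Hg.
  - eapply ex_diff_n_ext_loc; [|apply (IH (fun x y => Derive (fun z => f x z) y)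
      (fun x y => Derive (fun z => g x z) y)); auto].
    + apply (locally_2d_strip a b); auto; intros u v Hu; symmetry; now apply is_derive_unique, Dy.
    + intros u v Hu; now apply Hf.
    + intros u v Hu; now apply Hg.
Qed.

Lemma cauchy_integral_smooth (a b a' b' c : R) (n : nat) (p q pr qr : R -> R -> R) :
  0 <= a -> a < c < b -> 0 <= a' -> c <= a' \/ b' <= c -> cr_pair a b p q pr qr ->
  forall x y, a' < x < b' ->
    ex_diff_n (fun x y => cauchy_integral p q x y c) n x y.
Proof.
  intros Ha Hc Ha' Hc' (H1 & H2 & _) x y Hx.
  assert (Hp : forall t, continuous (p c) t)
    by (intros; apply continuity_2d_pt_snd; now apply H1).
  assert (Hq : forall t, continuous (q c) t)
    by (intros; apply continuity_2d_pt_snd; now apply H2).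
  (* Codes of [poisson x c] and [poisson_conj x c] as functions of the pole radius [x], the circle
     [c] being fixed. *)
  set (eP := KMul (KAdd (KConst (c ^ 2)) (KMul (KConst (-1)) (KMul KRad KRad))) KInvDen).
  set (eQ := KMul (KMul (KConst (2 * c)) (KMul KRad KSin)) KInvDen).
  apply (ex_diff_n_ext_loc
    (fun x y => 1 * kernel_integral c (p c) eP x y + (-1) * kernel_integral c (q c) eQ x y)).
  - apply (locally_2d_strip a' b'); auto; intros u v Hu.
    unfold cauchy_integral, kernel_integral.
    assert (I : forall g e, (forall t, continuous g t) ->
      is_RInt (fun t => g t * keval c e u (t - v)) 0 (2 * PI)
        (RInt (fun t => g t * keval c e u (t - v)) 0 (2 * PI))).
    { intros g e Hg; apply (RInt_correct (V := R_CompleteNormedModule)), continuous_ex_RInt.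
      intros t; apply (continuity_2d_pt_snd (fun x t => g t * keval c e x (t - v)) u t).
      apply continuity_2d_pt_mult; [now apply continuity_2d_pt_density|].
      apply (keval_continuous c u t (fun r _ => r) (fun _ t => t - v)); try lra; cont2d. }
    symmetry; apply is_RInt_unique.
    pose proof (is_RInt_minus _ _ _ _ _ _ (I (p c) eP Hp) (I (q c) eQ Hq)) as D.
    evar_last; [eapply is_RInt_ext; [|exact D]|].
    + intros t _.
      unfold minus, plus, opp; simpl.
      unfold poisson, poisson_conj, Rdiv; ring.
    + unfold minus, plus, opp; simpl; ring.
  - apply (ex_diff_n_lin a' b'); auto; intros; apply (kernel_integral_smooth a' b'); auto; lra.
Qed.

(** The two circles stay fixed while the pole moves between them, so Cauchy's formula is an identity
    of functions near [(x, y)] whose integral side is smooth. *)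
Lemma cr_pair_smooth (a b : R) (n : nat) (p q pr qr : R -> R -> R) :
  0 <= a -> cr_pair a b p q pr qr ->
  forall x y, a < x < b -> ex_diff_n p n x y.
Proof.
  intros Ha H x y Hx.
  set (ra := (a + x) / 2); set (rb := (x + b) / 2).
  assert (Hra : a < ra < x) by (unfold ra; lra).
  assert (Hrb : x < rb < b) by (unfold rb; lra).
  pose proof poisson_mass_pos.
  apply (ex_diff_n_ext_loc (fun x y => / (2 * poisson_mass) * cauchy_integral p q x y rb
    + - / (2 * poisson_mass) * cauchy_integral p q x y ra)).
  - apply (locally_2d_strip ra rb); [lra|]; intros u v Hu.
    pose proof (cauchy_integral_formula a b u v ra rb p q pr qr Ha ltac:(lra) ltac:(lra)
      ltac:(lra) H) as E.
    replace (p u v) with (/ (2 * poisson_mass) * (2 * poisson_mass * p u v)) by (field; lra).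
    rewrite <- E; ring.
  - apply (ex_diff_n_lin ra rb); [| |lra].
    + intros u v Hu; apply (cauchy_integral_smooth a b ra rb rb n p q pr qr); auto; lra.
    + intros u v Hu; apply (cauchy_integral_smooth a b ra rb ra n p q pr qr); auto; lra.
Qed.

(** * Uniqueness for the Dirichlet problem *)

(* Composing with [clamp] turns continuity on the closed strip into continuity
   on the whole plane. *)
Definition clamp (a b r : R) : R := Rmax a (Rmin b r).

Lemma clamp_bounds (a b r : R) : a <= b -> a <= clamp a b r <= b.
Proof. unfold clamp, Rmax, Rmin; repeat destruct Rle_dec; lra. Qed.

Lemma clamp_id (a b r : R) : a <= r <= b -> clamp a b r = r.
Proof. unfold clamp, Rmax, Rmin; repeat destruct Rle_dec; lra. Qed.

Lemma clamp_lipschitz (a b r s : R) : Rabs (clamp a b r - clamp a b s) <= Rabs (r - s).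
Proof.
  unfold clamp, Rmax, Rmin; repeat destruct Rle_dec; unfold Rabs; repeat destruct Rcase_abs; lra.
Qed.

Lemma continuous_clamp (a b r : R) : continuous (clamp a b) r.
Proof.
  apply filterlim_locally; intros eps; exists eps; intros s Hs.
  eapply Rle_lt_trans; [apply clamp_lipschitz|exact Hs].
Qed.

Lemma jointly_continuous_clamp (a b : R) (f : R -> R -> R) :
  a <= b ->
  jointly_continuous_on (closed_strip a b) f <->
  (forall r t, continuity_2d_pt (fun r t => f (clamp a b r) t) r t).
Proof.
  intros Hab; split.
  - intros H r t; apply continuity_2d_pt_filterlim; simpl.
    intros P HP.
    destruct (H (clamp a b r, t) (clamp_bounds a b r Hab) P HP) as [d Hd].
    exists d; intros z [Hz1 Hz2].
    apply (Hd (clamp a b (fst z), snd z)); [split; [|exact Hz2]|apply clamp_bounds, Hab].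
    eapply Rle_lt_trans; [apply clamp_lipschitz|exact Hz1].
  - intros H [r t] Hr P HP; unfold closed_strip in Hr; simpl in Hr.
    pose proof (proj1 (continuity_2d_pt_filterlim _ _ _) (H r t)) as C; simpl in C.
    rewrite clamp_id in C by exact Hr.
    destruct (C P HP) as [d Hd]; exists d; intros z Hz Dz.
    specialize (Hd z Hz); rewrite clamp_id in Hd by exact Dz; exact Hd.
Qed.

Lemma continuity_2d_pt_comp_fst (f : R -> R -> R) (g : R -> R) (x y : R) :
  continuous g x -> continuity_2d_pt f (g x) y ->
  continuity_2d_pt (fun u v => f (g u) v) x y.
Proof.
  intros Hg Hf eps.
  destruct (Hf eps) as [d Hd].
  destruct (proj1 (filterlim_locally _ _) Hg d) as [d' Hd'].
  assert (Hm : 0 < Rmin d d') by (apply Rmin_glb_lt; apply cond_pos).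
  exists (mkposreal _ Hm); simpl; intros u v Hu Hv.
  pose proof (Rmin_l d d'); pose proof (Rmin_r d d').
  apply Hd; [apply (Hd' u); apply (Rlt_le_trans _ _ _ Hu); lra|lra].
Qed.

Lemma continuous_RInt_param (f : R -> R -> R) (c d : R) :
  c <= d -> (forall r t, continuity_2d_pt f r t) ->
  forall r, continuous (fun r => RInt (f r) c d) r.
Proof.
  intros Hcd Hf r; apply filterlim_locally; intros eps.
  (* The added 1 keeps the divisor positive when [c = d] and makes the final inequality strict. *)
  assert (He : 0 < eps / (d - c + 1)) by (apply Rdiv_lt_0_compat; [apply cond_pos|lra]).
  destruct (uniform_continuity_2d_1d' f c d r (fun t _ => Hf r t) (mkposreal _ He)) as [del Hdel].
  simpl in Hdel; exists del; intros s Hs.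
  assert (I : forall r, is_RInt (f r) c d (RInt (f r) c d)).
  { intros; apply (RInt_correct (V := R_CompleteNormedModule)), continuous_ex_RInt.
    intros; now apply continuity_2d_pt_snd. }
  pose proof (is_RInt_minus _ _ _ _ _ _ (I s) (I r)) as D.
  assert (B : forall t, Rmin c d <= t <= Rmax c d ->
    Rabs (f s t - f r t) <= eps / (d - c + 1)).
  { intros t Ht; rewrite Rmin_left, Rmax_right in Ht by lra.
    assert (Hs' : Rabs (s - r) < del) by exact Hs.
    apply Rabs_def2 in Hs'.
    apply Rlt_le, Hdel; try lra; rewrite ?Rminus_eq_0, ?Rabs_R0; pose proof (cond_pos del); lra. }
  apply (norm_RInt_le_const_abs (V := R_NormedModule) _ _ _ _ _ B) in D.
  change (Rabs (RInt (f s) c d - RInt (f r) c d) < eps).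
  change (Rabs (RInt (f s) c d - RInt (f r) c d) <= Rabs (d - c) * (eps / (d - c + 1))) in D.
  rewrite (Rabs_pos_eq (d - c)) in D by lra.
  apply (Rle_lt_trans _ _ _ D).
  replace (pos eps) with ((d - c + 1) * (eps / (d - c + 1))) at 2 by (field; lra).
  apply Rmult_lt_compat_r; lra.
Qed.

Lemma RInt_periodic_eq_0 (h : R -> R) :
  (forall t, continuous h t) -> (forall t, h (t + 2 * PI) = h t) -> (forall t, 0 <= h t) ->
  RInt h 0 (2 * PI) = 0 -> forall t, h t = 0.
Proof.
  intros Hc Hp H0 HI t; apply Rle_antisym; [|apply H0].
  apply Rnot_lt_le; intros Ht.
  pose proof PI_RGT_0 as HPI.
  assert (Hc' : forall s, continuous (fun s => h (t + s)) s).
  { intros s; apply (continuous_comp (fun s => t + s) h); [|apply Hc].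
    apply (ex_derive_continuous (fun s => t + s)); auto_derive; auto. }
  (* With the period centred at [t], a whole neighbourhood of [t] lies inside and contributes a
     positive amount. *)
  rewrite (RInt_periodic_center h t Hc Hp) in HI.
  destruct (proj1 (filterlim_locally _ _) (Hc t) (mkposreal _ Ht)) as [d Hd].
  set (m := Rmin (d / 2) PI).
  assert (Hm : 0 < m /\ m < d /\ m <= PI).
  { pose proof (cond_pos d); pose proof (Rmin_l (d / 2) PI); pose proof (Rmin_r (d / 2) PI).
    unfold m; split; [apply Rmin_glb_lt; lra|lra]. }
  assert (E : forall u v, ex_RInt (fun s => h (t + s)) u v)
    by (intros; now apply continuous_ex_RInt).
  pose proof (RInt_Chasles _ _ _ _ (E (- PI) (- m)) (E (- m) PI)) as C1.
  pose proof (RInt_Chasles _ _ _ _ (E (- m) m) (E m PI)) as C2.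
  pose proof (RInt_ge_0 _ (- PI) (- m) ltac:(lra) (E _ _) (fun s _ => H0 (t + s))) as P1.
  pose proof (RInt_ge_0 _ m PI ltac:(lra) (E _ _) (fun s _ => H0 (t + s))) as P2.
  assert (P3 : 0 < RInt (fun s => h (t + s)) (- m) m).
  { apply RInt_gt_0; [lra| |auto].
    intros s Hs.
    assert (B : Rabs (h (t + s) - h t) < h t).
    { apply (Hd (t + s)); change (Rabs (t + s - t) < d).
      replace (t + s - t) with s by ring; apply Rabs_def1; lra. }
    apply Rabs_def2 in B; lra. }
  unfold plus in *; simpl in *; lra.
Qed.

(** The intermediate point is strictly inside. [polar_harmonic_zero] applies the lemma again between
    two such points, and derivatives are known there in the open interval only. *)
Lemma MVT_open (f df : R -> R) (a b : R) :
  a < b -> (forall x, a < x < b -> is_derive f x (df x)) ->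
  (forall x, a <= x <= b -> continuity_pt f x) ->
  exists c, a < c < b /\ f b - f a = df c * (b - a).
Proof.
  intros Hab Hd Hc.
  assert (pr : forall c, a < c < b -> derivable_pt f c).
  { intros c Hc'; exists (df c); now apply is_derive_Reals, Hd. }
  destruct (MVT f id a b pr (fun c _ => derivable_pt_id c) Hab Hc
    (fun c _ => derivable_continuous_pt _ _ (derivable_pt_id c))) as (c & P & E).
  exists c; split; [exact P|].
  rewrite (Derive_Reals f c (pr c P)) in E; rewrite (is_derive_unique f c (df c) (Hd c P)) in E.
  rewrite derive_pt_id in E; unfold id in E; lra.
Qed.

Record polar_harmonic (a b : R) (w wr wt wrr wtt : R -> R -> R) : Prop := {
  ph_r : forall r t, a < r < b -> is_derive (fun s => w s t) r (wr r t);
  ph_t : forall r t, a < r < b -> is_derive (w r) t (wt r t);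
  ph_rr : forall r t, a < r < b -> is_derive (fun s => wr s t) r (wrr r t);
  ph_tt : forall r t, a < r < b -> is_derive (wt r) t (wtt r t);
  ph_c : forall r t, a < r < b -> continuity_2d_pt w r t;
  ph_cr : forall r t, a < r < b -> continuity_2d_pt wr r t;
  ph_ct : forall r t, a < r < b -> continuity_2d_pt wt r t;
  ph_crr : forall r t, a < r < b -> continuity_2d_pt wrr r t;
  ph_ctt : forall r t, a < r < b -> continuity_2d_pt wtt r t;
  ph_per : forall r t, a < r < b -> w r (t + 2 * PI) = w r t;
  ph_eq : forall r t, a < r < b -> wrr r t + / r * wr r t + / r ^ 2 * wtt r t = 0
}.

Lemma polar_harmonic_minus (a b : R) (w wr wt wrr wtt v vr vt vrr vtt : R -> R -> R) :
  polar_harmonic a b w wr wt wrr wtt -> polar_harmonic a b v vr vt vrr vtt ->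
  polar_harmonic a b (fun r t => w r t - v r t) (fun r t => wr r t - vr r t)
    (fun r t => wt r t - vt r t) (fun r t => wrr r t - vrr r t) (fun r t => wtt r t - vtt r t).
Proof.
  intros [] []; constructor; intros r t Hr.
  1-4: eapply is_derive_Rminus; eauto.
  1-5: apply continuity_2d_pt_minus; auto.
  - now rewrite ph_per0, ph_per1.
  - pose proof (ph_eq0 r t Hr); pose proof (ph_eq1 r t Hr); lra.
Qed.

(** In [ln r] the map [r -> a b / r] is a reflection, which preserves [r^2] times the Laplace
    operator, the plain Laplacian in [(ln r, t)]. It exchanges the two boundary circles. *)
Lemma polar_harmonic_inversion (a b : R) (w wr wt wrr wtt : R -> R -> R) :
  0 < a -> polar_harmonic a b w wr wt wrr wtt ->
  polar_harmonic a b (fun r t => w (a * b / r) t)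
    (fun r t => - (a * b / r ^ 2) * wr (a * b / r) t)
    (fun r t => wt (a * b / r) t)
    (fun r t => 2 * (a * b) / r ^ 3 * wr (a * b / r) t
                + (a * b / r ^ 2) ^ 2 * wrr (a * b / r) t)
    (fun r t => wtt (a * b / r) t).
Proof.
  intros Ha H.
  assert (K : forall r, a < r < b -> a < a * b / r < b).
  { intros r Hr; split; [apply Rlt_div_r; nra|apply Rlt_div_l; nra]. }
  assert (Kd : forall r, a < r < b ->
    is_derive (fun r => a * b / r) r (- (a * b / r ^ 2))).
  { intros r Hr; auto_derive; [lra|field; lra]. }
  assert (Kc : forall r, a < r < b -> continuous (fun r => a * b / r) r).
  { intros r Hr; apply (ex_derive_continuous (fun r => a * b / r)); eexists; now apply Kd. }
  assert (Ki : forall c n r t, a < r < b -> continuity_2d_pt (fun r _ => c / r ^ n) r t).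
  { intros c n r t Hr; apply (continuity_1d_2d_pt_comp (fun r => c / r ^ n) (fun r _ => r)); [|cont2d].
    apply continuity_pt_filterlim, (ex_derive_continuous (fun r => c / r ^ n)).
    auto_derive; apply pow_nonzero; lra. }
  destruct H; constructor; intros r t Hr; specialize (K r Hr).
  - apply (is_derive_comp (fun s => w s t) (fun r => a * b / r)); auto.
  - auto.
  - eapply is_derive_Rmult.
    + assert (D : is_derive (fun r => - (a * b / r ^ 2)) r (2 * (a * b) / r ^ 3))
        by (auto_derive; [|field]; nra); exact D.
    + apply (is_derive_comp (fun s => wr s t) (fun r => a * b / r)); auto.
    + unfold scal; simpl; unfold mult; simpl; field; lra.
  - auto.
  - apply (continuity_2d_pt_comp_fst w (fun r => a * b / r)); auto.
  - apply continuity_2d_pt_mult; [apply continuity_2d_pt_opp, Ki, Hr|].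
    apply (continuity_2d_pt_comp_fst wr (fun r => a * b / r)); auto.
  - apply (continuity_2d_pt_comp_fst wt (fun r => a * b / r)); auto.
  - apply continuity_2d_pt_plus; apply continuity_2d_pt_mult.
    + apply Ki, Hr.
    + apply (continuity_2d_pt_comp_fst wr (fun r => a * b / r)); auto.
    + pose proof (Ki (a * b) 2%nat r t Hr); cont2d.
    + apply (continuity_2d_pt_comp_fst wrr (fun r => a * b / r)); auto.
  - apply (continuity_2d_pt_comp_fst wtt (fun r => a * b / r)); auto.
  - auto.
  - pose proof (ph_eq0 (a * b / r) t K) as E.
    assert (0 < b) by lra.
    replace (2 * (a * b) / r ^ 3 * wr (a * b / r) t + (a * b / r ^ 2) ^ 2 * wrr (a * b / r) t +
      / r * (- (a * b / r ^ 2) * wr (a * b / r) t) + / r ^ 2 * wtt (a * b / r) t)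
      with ((a * b / r ^ 2) ^ 2 * (wrr (a * b / r) t + / (a * b / r) * wr (a * b / r) t +
        / (a * b / r) ^ 2 * wtt (a * b / r) t)) by (field; lra).
    rewrite E; ring.
Qed.

(* [F(r) = int w^2 dt] satisfies [(r F')' >= 0], so it is convex in [ln r] and
   vanishes at both ends. *)
Lemma polar_harmonic_zero (a b : R) (w wr wt wrr wtt : R -> R -> R) :
  0 < a -> a < b -> polar_harmonic a b w wr wt wrr wtt ->
  (forall r t, continuity_2d_pt (fun r t => w (clamp a b r) t) r t) ->
  (forall t, w a t = 0) -> (forall t, w b t = 0) ->
  forall r t, a <= r <= b -> w r t = 0.
Proof.
  intros Ha Hab H HC Hwa Hwb.
  pose proof PI_RGT_0 as HPI.
  set (f := fun r t => w (clamp a b r) t * w (clamp a b r) t).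
  set (F := fun r => RInt (f r) 0 (2 * PI)).
  assert (Cf : forall r t, continuity_2d_pt f r t)
    by (intros; apply continuity_2d_pt_mult; apply HC).
  assert (CF : forall r, continuous F r)
    by (apply continuous_RInt_param; [lra|exact Cf]).
  assert (E0 : forall g : R -> R, (forall t, g t = 0) -> RInt g 0 (2 * PI) = 0).
  { intros g Hg; rewrite (RInt_ext _ (fun _ => 0)) by auto.
    rewrite RInt_const; unfold scal; simpl; unfold mult; simpl; ring. }
  assert (Fa : F a = 0).
  { apply E0; intros t; unfold f; rewrite clamp_id by lra; rewrite Hwa; ring. }
  assert (Fb : F b = 0).
  { apply E0; intros t; unfold f; rewrite clamp_id by lra; rewrite Hwb; ring. }
  assert (F0 : forall r, 0 <= F r).
  { intros r; apply RInt_ge_0; [lra| |].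
    - apply continuous_ex_RInt; intros; now apply continuity_2d_pt_snd.
    - intros; unfold f; nra. }
  set (G := fun r => RInt (fun t => 2 * (w r t * wr r t)) 0 (2 * PI)).
  assert (DF : forall r, a < r < b -> is_derive F r (G r)).
  { apply (is_derive_RInt_strip a b 0 (2 * PI) f); [| |]; intros r t Hr; auto.
    - apply (is_derive_ext_loc (fun s => w s t * w s t)).
      + apply (locally_open_interval a b); auto; intros s Hs; unfold f; rewrite clamp_id by lra; auto.
      + eapply is_derive_Rmult; try (now apply (ph_r _ _ _ _ _ _ _ H)); ring.
    - pose proof (ph_c _ _ _ _ _ _ _ H r t Hr); pose proof (ph_cr _ _ _ _ _ _ _ H r t Hr); cont2d. }
  (* Integrand of [(r F')'], with [w_rr] eliminated by the Laplace equation. *)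
  set (h := fun r t => 2 * r * (wr r t * wr r t) - 2 / r * (w r t * wtt r t)).
  assert (DG : forall r, a < r < b ->
    is_derive (fun r => RInt (fun t => 2 * r * (w r t * wr r t)) 0 (2 * PI)) r
      (RInt (h r) 0 (2 * PI))).
  { apply (is_derive_RInt_strip a b 0 (2 * PI) (fun r t => 2 * r * (w r t * wr r t)));
      intros r t Hr; pose proof (ph_c _ _ _ _ _ _ _ H r t Hr) as c1;
      pose proof (ph_cr _ _ _ _ _ _ _ H r t Hr) as c2;
      pose proof (ph_ctt _ _ _ _ _ _ _ H r t Hr) as c3; try now cont2d.
    - eapply is_derive_Rmult.
      + assert (D : is_derive (fun r => 2 * r) r 2) by (auto_derive; auto; ring); exact D.
      + eapply is_derive_Rmult; [now apply (ph_r _ _ _ _ _ _ _ H)|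
          now apply (ph_rr _ _ _ _ _ _ _ H)|reflexivity].
      + pose proof (ph_eq _ _ _ _ _ _ _ H r t Hr) as E.
        assert (E' : wrr r t = - / r * wr r t - / r ^ 2 * wtt r t) by lra.
        unfold h; rewrite E'; field; lra.
    - apply continuity_2d_pt_minus; [cont2d|].
      apply continuity_2d_pt_mult; [|cont2d].
      apply continuity_2d_pt_mult; [cont2d|].
      apply (continuity_2d_pt_inv (fun r _ => r)); [cont2d|lra]. }
  assert (IG : forall r, a < r < b ->
    RInt (fun t => 2 * r * (w r t * wr r t)) 0 (2 * PI) = r * G r).
  { intros r Hr; apply is_RInt_unique.
    assert (J : is_RInt (fun t => 2 * (w r t * wr r t)) 0 (2 * PI) (G r)).
    { apply (RInt_correct (V := R_CompleteNormedModule)), continuous_ex_RInt; intros t.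
      pose proof (ph_c _ _ _ _ _ _ _ H r t Hr); pose proof (ph_cr _ _ _ _ _ _ _ H r t Hr).
      apply (continuity_2d_pt_snd (fun r t => 2 * (w r t * wr r t))); cont2d. }
    eapply is_RInt_ext; [|exact (is_RInt_scal _ _ _ r _ J)].
    intros t _; unfold scal; simpl; unfold mult; simpl; ring. }
  assert (Pt : forall r t, a < r < b -> wt r (t + 2 * PI) = wt r t).
  { intros r t Hr.
    pose proof (ph_t _ _ _ _ _ _ _ H r t Hr) as D1.
    pose proof (ph_t _ _ _ _ _ _ _ H r (t + 2 * PI) Hr) as D2.
    assert (D3 : is_derive (w r) t (wt r (t + 2 * PI))).
    { apply (is_derive_ext (fun t => w r (t + 2 * PI))).
      - intros; now apply (ph_per _ _ _ _ _ _ _ H).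
      - evar_last; [apply (is_derive_comp (w r) (fun t => t + 2 * PI) t (wt r (t + 2 * PI)) 1 D2)|].
        + auto_derive; auto; ring.
        + unfold scal; simpl; unfold mult; simpl; ring. }
    rewrite <- (is_derive_unique _ _ _ D1); symmetry; now apply is_derive_unique. }
  assert (H0 : forall r, a < r < b -> 0 <= RInt (h r) 0 (2 * PI)).
  { intros r Hr.
    assert (c : forall t, continuity_2d_pt w r t /\ continuity_2d_pt wr r t /\
      continuity_2d_pt wt r t /\ continuity_2d_pt wtt r t)
      by (intros t; destruct H; auto).
    assert (I1 : is_RInt (h r) 0 (2 * PI) (RInt (h r) 0 (2 * PI))).
    { apply (RInt_correct (V := R_CompleteNormedModule)), continuous_ex_RInt; intros t.
      destruct (c t) as (c1 & c2 & c3 & c4).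
      apply (continuity_2d_pt_snd (fun r' t => 2 * r * (wr r' t * wr r' t)
        - 2 / r * (w r' t * wtt r' t))); cont2d. }
    (* The derivative of [w w_t] integrates to 0 over a period; adding [2 / r] times it replaces
       [- w w_tt] by [w_t^2], and leaves a sum of squares. *)
    assert (I2 : is_RInt (fun t => wt r t * wt r t + w r t * wtt r t) 0 (2 * PI)
      (minus (w r (2 * PI) * wt r (2 * PI)) (w r 0 * wt r 0))).
    { apply (is_RInt_derive (fun t => w r t * wt r t)); intros t _.
      - eapply is_derive_Rmult; [now apply (ph_t _ _ _ _ _ _ _ H)|
          now apply (ph_tt _ _ _ _ _ _ _ H)|reflexivity].
      - destruct (c t) as (c1 & c2 & c3 & c4).
        apply (continuity_2d_pt_snd (fun r t => wt r t * wt r t + w r t * wtt r t)); cont2d. }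
    pose proof (is_RInt_plus _ _ _ _ _ _ I1 (is_RInt_scal _ _ _ (2 / r) _ I2)) as I3.
    assert (E : w r (2 * PI) * wt r (2 * PI) = w r 0 * wt r 0).
    { rewrite <- (Pt r 0), <- (ph_per _ _ _ _ _ _ _ H r 0), Rplus_0_l by lra; reflexivity. }
    rewrite E in I3.
    pose proof (RInt_ge_0 _ 0 (2 * PI) ltac:(lra) (ex_intro _ _ I3)) as P.
    rewrite (is_RInt_unique _ _ _ _ I3) in P.
    match type of P with ?A -> _ => change (A -> 0 <= RInt (h r) 0 (2 * PI)
      + 2 / r * (w r 0 * wt r 0 - w r 0 * wt r 0)) in P end.
    rewrite Rminus_eq_0, Rmult_0_r, Rplus_0_r in P; apply P.
    intros t _; unfold plus, scal, h; simpl; unfold mult; simpl.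
    replace (2 * r * (wr r t * wr r t) - 2 / r * (w r t * wtt r t) +
      2 / r * (wt r t * wt r t + w r t * wtt r t))
      with (2 * r * (wr r t * wr r t) + 2 / r * (wt r t * wt r t)) by ring.
    apply Rplus_le_le_0_compat; apply Rmult_le_pos; try nra.
    apply Rdiv_le_0_compat; lra. }
  (* A positive value between the two zeros gives [F' > 0] at some [x1] and [F' < 0] at some
     [x2 > x1], although [r F'] is nondecreasing. *)
  assert (FZ : forall r, a < r < b -> F r = 0).
  { intros r Hr; apply Rle_antisym; [|apply F0]; apply Rnot_lt_le; intros Hlt.
    assert (CFp : forall r, continuity_pt F r) by (intros; apply continuity_pt_filterlim, CF).
    destruct (MVT_open F G a r) as [x1 [Hx1 E1]]; [lra|intros; apply DF; lra|auto|].
    destruct (MVT_open F G r b) as [x2 [Hx2 E2]]; [lra|intros; apply DF; lra|auto|].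
    assert (G1 : 0 < G x1).
    { apply (Rmult_lt_reg_r (r - a)); lra. }
    assert (G2 : G x2 < 0).
    { apply (Rmult_lt_reg_r (b - r)); lra. }
    destruct (MVT_open (fun r => RInt (fun t => 2 * r * (w r t * wr r t)) 0 (2 * PI))
      (fun r => RInt (h r) 0 (2 * PI)) x1 x2) as [z [Hz Ez]]; [lra|intros; apply DG; lra| |].
    { intros x Hx; apply continuity_pt_filterlim.
      apply (ex_derive_continuous (fun r => RInt (fun t => 2 * r * (w r t * wr r t)) 0 (2 * PI))).
      eexists; apply DG; lra. }
    cbv beta in Ez; rewrite !IG in Ez by lra.
    pose proof (H0 z ltac:(lra)); nra. }
  intros r t Hr.
  destruct (Req_dec r a) as [->|Hra]; [apply Hwa|].
  destruct (Req_dec r b) as [->|Hrb]; [apply Hwb|].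
  assert (Z : f r t = 0).
  { apply RInt_periodic_eq_0.
    - intros; now apply continuity_2d_pt_snd.
    - intros s; unfold f; rewrite clamp_id by lra.
      now rewrite (ph_per _ _ _ _ _ _ _ H) by lra.
    - intros; unfold f; nra.
    - apply FZ; lra. }
  unfold f in Z; rewrite clamp_id in Z by lra; nra.
Qed.

(** * From the Neumann to the Dirichlet problem *)

Lemma C1_strip_Cn (a b : R) (n : nat) (f : R -> R -> R) :
  Cn_on (S n) (open_strip a b) f ->
  C1_strip a b f (fun r t => Derive (fun s => f s t) r) (fun r t => Derive (f r) t).
Proof.
  intros H r t Hr; destruct (H r t Hr) as (c & dr & dt & fr & ft).
  split; [now apply Derive_correct|].
  split; [now apply Derive_correct|].
  split; [exact c|].
  split; [destruct n; apply fr|destruct n; apply ft].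
Qed.

Lemma Cn_on_Derive_r (a b : R) (n : nat) (f : R -> R -> R) :
  Cn_on (S n) (open_strip a b) f ->
  Cn_on n (open_strip a b) (fun r t => Derive (fun s => f s t) r).
Proof. intros H r t Hr; apply (H r t Hr). Qed.

Lemma Cn_on_Derive_t (a b : R) (n : nat) (f : R -> R -> R) :
  Cn_on (S n) (open_strip a b) f ->
  Cn_on n (open_strip a b) (fun r t => Derive (f r) t).
Proof. intros H r t Hr; apply (H r t Hr). Qed.

Lemma Cn_on_Schwarz (a b : R) (f : R -> R -> R) :
  Cn_on 2 (open_strip a b) f ->
  forall r t, a < r < b ->
    Derive (fun s => Derive (f s) t) r = Derive (fun s => Derive (fun z => f z s) r) t.
Proof.
  intros H r t Hr.
  pose proof (C1_strip_Cn a b 1 f H) as H1.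
  pose proof (C1_strip_Cn a b 0 _ (Cn_on_Derive_r a b 1 f H)) as H2.
  pose proof (C1_strip_Cn a b 0 _ (Cn_on_Derive_t a b 1 f H)) as H3.
  apply (Schwarz f r t).
  - apply (locally_2d_strip a b); auto; intros u v Hu.
    split; [|split; [|split]]; eexists; [apply (H1 u v Hu)|apply (H1 u v Hu)|
      apply (H3 u v Hu)|apply (H2 u v Hu)].
  - apply (H3 r t Hr).
  - apply (H2 r t Hr).
Qed.

Lemma cr_pair_laplace (a b : R) (p q pr qr : R -> R -> R) :
  0 <= a -> cr_pair a b p q pr qr -> polar_laplace_eq (open_strip a b) p.
Proof.
  intros Ha H r t Hr.
  assert (Sp : Cn_on 2 (open_strip a b) p)
    by (intros x y Hx; now apply (cr_pair_smooth a b 2 p q pr qr)).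
  (* Exchanging the mixed derivatives of [q] requires [q] to be [C^2] as well; [(q, - p)] is a pair
     too. *)
  assert (Sq : Cn_on 2 (open_strip a b) q).
  { intros x y Hx; apply (cr_pair_smooth a b 2 q (fun r t => - p r t) qr (fun r t => - pr r t));
      auto; now apply cr_pair_conj. }
  destruct H as (H1 & H2 & _).
  pose proof (C1_strip_Cn a b 0 _ (Cn_on_Derive_r a b 1 p Sp)) as P2.
  pose proof (Cn_on_Schwarz a b q Sq r t Hr) as SW.
  unfold open_strip in Hr; simpl in Hr.
  change (Derive (fun x => Derive (fun z => p z t) x) r
    + / r * Derive (fun z => p z t) r
    + / r ^ 2 * Derive (fun y => Derive (fun z => p r z) y) t = 0).
  (* [p_tt = r (q_r)_t] and [(r p_r)_r = - (q_t)_r]. *)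
  assert (E1 : Derive (fun y => Derive (fun z => p r z) y) t
    = r * Derive (fun s => Derive (fun z => q z s) r) t).
  { rewrite <- Derive_scal; apply Derive_ext; intros s.
    transitivity (r * qr r s); [apply is_derive_unique, (H1 r s Hr)|].
    f_equal; symmetry; apply is_derive_unique, (H2 r s Hr). }
  assert (E2 : - Derive (fun s => Derive (q s) t) r
    = Derive (fun z => p z t) r + r * Derive (fun x => Derive (fun z => p z t) x) r).
  { rewrite <- Derive_opp.
    transitivity (Derive (fun s => s * Derive (fun z => p z t) s) r).
    - apply Derive_ext_loc, (locally_open_interval a b); auto; intros s Hs.
      rewrite (is_derive_unique (q s) t (- (s * pr s t))) by apply (H2 s t Hs).
      assert (e : Derive (fun z : R => p z t) s = pr s t)
        by (apply is_derive_unique, (H1 s t Hs)).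
      rewrite e; ring.
    - apply is_derive_unique; eapply is_derive_Rmult;
        [apply (is_derive_id (K := R_AbsRing))|apply (P2 r t Hr)|].
      unfold one; simpl; ring. }
  rewrite E1, <- SW.
  replace (Derive (fun s => Derive (q s) t) r) with
    (- (Derive (fun z => p z t) r + r * Derive (fun x => Derive (fun z => p z t) x) r))
    by (rewrite <- E2; ring).
  field; lra.
Qed.

(** One Cauchy-Riemann equation is the symmetry of the second derivatives of [U], the other is the
    Laplace equation times [r^2]. *)
Lemma polar_laplace_cr_pair (a b : R) (U : R -> R -> R) :
  0 <= a -> Cn_on 2 (open_strip a b) U -> periodic_on (open_strip a b) U ->
  polar_laplace_eq (open_strip a b) U ->
  cr_pair a b (fun r t => r * Derive (fun s => U s t) r) (fun r t => Derive (U r) t)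
    (fun r t => Derive (fun s => U s t) r + r * Derive (fun x => Derive (fun s => U s t) x) r)
    (fun r t => Derive (fun s => Derive (U s) t) r).
Proof.
  intros Ha HU HP HL.
  pose proof (C1_strip_Cn a b 0 _ (Cn_on_Derive_r a b 1 U HU)) as Hr2.
  pose proof (C1_strip_Cn a b 0 _ (Cn_on_Derive_t a b 1 U HU)) as Ht2.
  pose proof (Cn_on_Schwarz a b U HU) as SW.
  split; [|split; [|split]].
  - intros r t Hr; destruct (Hr2 r t Hr) as (A & B & C & D & E).
    destruct (Ht2 r t Hr) as (A' & B' & C' & D' & E').
    split; [|split; [|split; [|split]]]; try now cont2d.
    + eapply is_derive_Rmult; [apply (is_derive_id (K := R_AbsRing))|exact A|].
      unfold one; simpl; ring.
    + rewrite SW by auto; now apply is_derive_scal.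
  - intros r t Hr; destruct (Hr2 r t Hr) as (A & B & C & D & E).
    destruct (Ht2 r t Hr) as (A' & B' & C' & D' & E').
    split; [|split; [|split; [|split]]]; auto; [|now cont2d].
    evar_last; [exact B'|].
    pose proof (HL r t Hr) as L.
    change (Derive (fun x => Derive (fun z => U z t) x) r
      + / r * Derive (fun z => U z t) r
      + / r ^ 2 * Derive (fun y => Derive (fun z => U r z) y) t = 0) in L.
    apply (Rmult_eq_reg_l (/ r ^ 2)); [|apply Rinv_neq_0_compat, pow_nonzero; lra].
    set (X := Derive (fun y => Derive (fun z => U r z) y) t) in *.
    change (Derive (fun t => Derive (U r) t) t) with X.
    set (Y := Derive (fun z => U z t) r) in *.
    set (Z := Derive (fun x => Derive (fun z => U z t) x) r) in *.
    transitivity (- (Z + / r * Y)); [lra|].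
    change (- (Z + / r * Y) = / r ^ 2 * - (r * (Y + r * Z))); field; lra.
  - intros r t Hr; cbv beta; f_equal; apply Derive_ext_loc, (locally_open_interval a b); auto.
  - intros r t Hr.
    transitivity (Derive (fun s => U r (s + 2 * PI)) t).
    + symmetry; apply is_derive_unique.
      evar_last; [apply (is_derive_comp (U r) (fun t => t + 2 * PI) t
        (Derive (U r) (t + 2 * PI)) 1)|].
      * apply Derive_correct, (HU r (t + 2 * PI) Hr).
      * auto_derive; auto; ring.
      * apply Rmult_1_l.
    + apply Derive_ext; intros s; now apply HP.
Qed.

Lemma dirichlet_polar_harmonic (a b : R) (phi u : R -> R -> R) :
  dirichlet_solution a b phi u ->
  polar_harmonic a b u (fun r t => Derive (fun s => u s t) r) (fun r t => Derive (u r) t)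
    (fun r t => Derive (fun x => Derive (fun s => u s t) x) r)
    (fun r t => Derive (fun y => Derive (u r) y) t).
Proof.
  intros (H2 & _ & HP & HL & _).
  pose proof (C1_strip_Cn a b 1 _ H2) as K1.
  pose proof (C1_strip_Cn a b 0 _ (Cn_on_Derive_r a b 1 u H2)) as Kr.
  pose proof (C1_strip_Cn a b 0 _ (Cn_on_Derive_t a b 1 u H2)) as Kt.
  constructor; intros r t Hr; try apply (K1 r t Hr); try apply (Kr r t Hr);
    try apply (Kt r t Hr).
  - apply HP; unfold closed_strip; simpl; lra.
  - exact (HL r t Hr).
Qed.

Lemma dirichlet_unique (a b : R) (phi u v : R -> R -> R) :
  0 < a -> a < b -> dirichlet_solution a b phi u -> dirichlet_solution a b phi v ->
  forall r t, a <= r <= b -> u r t = v r t.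
Proof.
  intros Ha Hab Hu Hv r t Hr.
  pose proof (polar_harmonic_minus _ _ _ _ _ _ _ _ _ _ _ _
    (dirichlet_polar_harmonic _ _ _ _ Hu) (dirichlet_polar_harmonic _ _ _ _ Hv)) as H.
  destruct Hu as (_ & Cu & _ & _ & Bu); destruct Hv as (_ & Cv & _ & _ & Bv).
  apply Rminus_diag_uniq; revert r t Hr.
  refine (polar_harmonic_zero _ _ _ _ _ _ _ Ha Hab H _ _ _).
  - intros r t; apply continuity_2d_pt_minus;
      [apply (jointly_continuous_clamp a b u)|apply (jointly_continuous_clamp a b v)]; auto; lra.
  - intros t; rewrite Bu, Bv; [ring|left; reflexivity|left; reflexivity].
  - intros t; rewrite Bu, Bv; [ring|right; reflexivity|right; reflexivity].
Qed.

(** Inversion gives a harmonic function with the boundary values exchanged; as these are equal, the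
    difference vanishes on both circles. *)
Lemma dirichlet_symmetric (a b : R) (phi u : R -> R -> R) :
  0 < a -> a < b -> dirichlet_solution a b phi u -> (forall t, phi a t = phi b t) ->
  forall r t, a <= r <= b -> u r t = u (a * b / r) t.
Proof.
  intros Ha Hab Hu Hphi r t Hr.
  pose proof (dirichlet_polar_harmonic _ _ _ _ Hu) as H0.
  pose proof (polar_harmonic_minus _ _ _ _ _ _ _ _ _ _ _ _ H0
    (polar_harmonic_inversion _ _ _ _ _ _ _ Ha H0)) as H.
  destruct Hu as (_ & Cu & _ & _ & Bu).
  apply Rminus_diag_uniq; revert r t Hr.
  assert (Ca : forall t, u a t = phi a t) by (intros; apply Bu; left; reflexivity).
  assert (Cb : forall t, u b t = phi b t) by (intros; apply Bu; right; reflexivity).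
  pose proof (proj1 (jointly_continuous_clamp a b u ltac:(lra)) Cu) as C.
  refine (polar_harmonic_zero _ _ _ _ _ _ _ Ha Hab H _ _ _).
  - intros r t; apply continuity_2d_pt_minus; auto.
    pose proof (fun r => clamp_bounds a b r ltac:(lra)) as Hb.
    (* Inversion preserves [[a, b]], so the outer [clamp] changes no value; with it the continuity
       of the clamped [u] applies. *)
    apply (continuity_2d_pt_ext (fun r t => u (clamp a b (a * b / clamp a b r)) t)).
    + intros x y; rewrite (clamp_id a b (a * b / clamp a b x)); auto.
      specialize (Hb x); split; [apply Rle_div_r; nra|apply Rle_div_l; nra].
    + apply (continuity_2d_pt_comp_fst (fun r t => u (clamp a b r) t)
        (fun r => a * b / clamp a b r)); auto.
      apply (continuous_comp (clamp a b) (fun r => a * b / r)); [apply continuous_clamp|].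
      apply (ex_derive_continuous (fun r => a * b / r)); auto_derive.
      specialize (Hb r); lra.
  - intros t; replace (a * b / a) with b by (field; lra); rewrite Ca, Cb, Hphi; ring.
  - intros t; replace (a * b / b) with a by (field; lra); rewrite Ca, Cb, Hphi; ring.
Qed.

Lemma continuous_zero_closed (a b : R) (h : R -> R) :
  a < b -> (forall r, continuous h r) -> (forall r, a < r < b -> h r = 0) ->
  forall r, a <= r <= b -> h r = 0.
Proof.
  intros Hab Hc H0 r Hr.
  destruct (Req_dec (h r) 0) as [|Hne]; [assumption|exfalso].
  assert (Hp : 0 < Rabs (h r)) by now apply Rabs_pos_lt.
  destruct (proj1 (filterlim_locally _ _) (Hc r) (mkposreal _ Hp)) as [d Hd].
  assert (B : forall s, Rabs (s - r) < d -> a < s < b -> False).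
  { intros s Hs Hsab; specialize (Hd s Hs).
    change (Rabs (h s - h r) < Rabs (h r)) in Hd.
    rewrite (H0 s Hsab) in Hd; replace (0 - h r) with (- h r) in Hd by ring.
    rewrite Rabs_Ropp in Hd; lra. }
  set (m := Rmin d (b - a) / 2).
  assert (Hm : 0 < m /\ m < d /\ m < b - a).
  { pose proof (cond_pos d); pose proof (Rmin_l d (b - a)); pose proof (Rmin_r d (b - a)).
    pose proof (Rmin_glb_lt d (b - a) 0); unfold m; lra. }
  destruct (Rlt_or_le (r + m) b).
  - apply (B (r + m)); [rewrite Rabs_pos_eq; lra|lra].
  - apply (B (r - Rmin m ((r - a) / 2))).
    + pose proof (Rmin_l m ((r - a) / 2)); pose proof (Rmin_glb m ((r - a) / 2) 0).
      replace (r - Rmin m ((r - a) / 2) - r) with (- Rmin m ((r - a) / 2)) by ring.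
      rewrite Rabs_Ropp, Rabs_pos_eq; lra.
    + pose proof (Rmin_l m ((r - a) / 2)); pose proof (Rmin_r m ((r - a) / 2)).
      pose proof (Rmin_glb_lt m ((r - a) / 2) 0); lra.
Qed.

Lemma jointly_continuous_unique (a b : R) (f g : R -> R -> R) :
  a < b -> jointly_continuous_on (closed_strip a b) f ->
  jointly_continuous_on (closed_strip a b) g ->
  (forall r t, a < r < b -> f r t = g r t) ->
  forall r t, a <= r <= b -> f r t = g r t.
Proof.
  intros Hab Hf Hg E r t Hr.
  rewrite (jointly_continuous_clamp a b) in Hf, Hg by lra.
  apply Rminus_diag_uniq.
  rewrite <- (clamp_id a b r Hr).
  apply (continuous_zero_closed a b (fun r => f (clamp a b r) t - g (clamp a b r) t)); auto.
  - intros s; apply (continuity_2d_pt_fst (fun r t => f (clamp a b r) t - g (clamp a b r) t) s t).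
    now apply continuity_2d_pt_minus.
  - intros s Hs; rewrite clamp_id by lra; rewrite E by auto; ring.
Qed.

Lemma neumann_radial_dirichlet (a b : R) (phi U Ur : R -> R -> R) :
  0 < a -> a < b -> neumann_solution a b phi U ->
  continuous_extension a b (partial_derive 1 0 U) Ur ->
  dirichlet_solution a b (fun r t => r * phi r t) (fun r t => r * Ur r t).
Proof.
  intros Ha Hab (HU & CU & PU & LU & Ur' & Ut & (CUr' & EUr') & _ & BU) (CUr & EUr).
  (* [Ur'] is the extension inside [neumann_solution]; it carries the boundary condition, which thus
     passes to the given [Ur]. *)
  assert (HE : forall r t, a <= r <= b -> Ur r t = Ur' r t).
  { apply (jointly_continuous_unique a b); auto.
    intros r t Hr; rewrite EUr, EUr'; auto. }
  assert (PU' : periodic_on (open_strip a b) U).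
  { intros r t Hr; apply PU; unfold open_strip, closed_strip in *; simpl in *; lra. }
  pose proof (polar_laplace_cr_pair a b U ltac:(lra) HU PU' LU) as CR.
  assert (EP : forall x y, a < x < b -> locally_2d
    (fun r t => r * Derive (fun s => U s t) r = r * Ur r t) x y).
  { intros x y Hx; apply (locally_2d_strip a b); auto; intros s t Hs.
    f_equal; symmetry; exact (EUr s t Hs). }
  split; [|split; [|split; [|split]]].
  - intros r t Hr.
    apply (ex_diff_n_ext_loc (fun r t => r * Derive (fun s => U s t) r)); [now apply EP|].
    apply (cr_pair_smooth a b 2 _ _ _ _ ltac:(lra) CR r t Hr).
  - apply jointly_continuous_clamp; [lra|]; intros r t; apply continuity_2d_pt_mult.
    + apply (continuity_1d_2d_pt_comp (clamp a b) (fun r _ => r)); [|cont2d].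
      apply continuity_pt_filterlim, continuous_clamp.
    + apply (jointly_continuous_clamp a b Ur); auto; lra.
  (* Inside, the periodicity of [U_r] comes from that of [U]; on the boundary circles it follows by
     continuity of the extension. *)
  - intros r t Hr; cbv beta; f_equal.
    revert r t Hr; apply (jointly_continuous_unique a b (fun r t => Ur r (t + 2 * PI)) Ur); auto.
    + apply jointly_continuous_clamp; [lra|]; intros r t.
      rewrite (jointly_continuous_clamp a b) in CUr by lra.
      intros eps; destruct (CUr r (t + 2 * PI) eps) as [d Hd].
      exists d; intros u v Hu Hv; apply Hd; auto.
      replace (v + 2 * PI - (t + 2 * PI)) with (v - t) by ring; auto.
    + intros r t Hr; rewrite !EUr by auto.
      change (Derive (fun s => U s (t + 2 * PI)) r = Derive (fun s => U s t) r).
      apply Derive_ext_loc, (locally_open_interval a b); auto; intros s Hs; now apply PU'.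
  - intros r t Hr.
    rewrite <- !(partial_derive_ext_loc _ _ _ _ _ _ (EP r t Hr)).
    exact (cr_pair_laplace a b _ _ _ _ ltac:(lra) CR r t Hr).
  - intros r t Hr; cbv beta; f_equal; rewrite HE; [now apply BU|].
    destruct Hr as [Hr|Hr]; simpl in Hr; lra.
Qed.

(** * Recovery of [U] from its radial derivative *)

Lemma sqrt_between (a b : R) : 0 < a -> a < b -> a < sqrt (a * b) < b.
Proof.
  intros Ha Hab; assert (S : 0 <= a * b) by nra.
  pose proof (sqrt_sqrt _ S); pose proof (sqrt_pos (a * b)); split; nra.
Qed.

Lemma neumann_mid_circle (a b : R) (phi U Ur : R -> R -> R) :
  0 < a -> a < b -> neumann_solution a b phi U ->
  continuous_extension a b (partial_derive 1 0 U) Ur ->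
  (forall t, a * phi a t = b * phi b t) ->
  forall t, U (sqrt (a * b)) t = U (sqrt (a * b)) 0.
Proof.
  intros Ha Hab HN HE Hphi t.
  pose proof (neumann_radial_dirichlet a b phi U Ur Ha Hab HN HE) as HD.
  pose proof (dirichlet_symmetric a b _ _ Ha Hab HD Hphi) as Sym; cbv beta in Sym.
  destruct HN as (HU & _ & PU & LU & _).
  set (s := sqrt (a * b)) in *.
  assert (Hs : a < s < b) by now apply sqrt_between.
  assert (Hs2 : s * s = a * b) by (apply sqrt_sqrt; nra).
  assert (PU' : periodic_on (open_strip a b) U).
  { intros r u Hr; apply PU; unfold open_strip, closed_strip in *; simpl in *; lra. }
  destruct (polar_laplace_cr_pair a b U ltac:(lra) HU PU' LU) as (C1 & C2 & _).
  set (p := fun r t => r * Derive (fun s => U s t) r) in *.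
  set (pr := fun r t => Derive (fun s => U s t) r
    + r * Derive (fun x => Derive (fun s => U s t) x) r) in *.
  assert (Ep : forall r u, a < r < b -> p r u = p (a * b / r) u).
  { intros r u Hr.
    assert (Hr' : a < a * b / r < b) by (split; [apply Rlt_div_r; nra|apply Rlt_div_l; nra]).
    unfold p; pose proof (Sym r u ltac:(lra)) as E.
    rewrite !(proj2 HE) in E by auto; exact E. }
  (* At its fixed point [s] the inversion has derivative -1, so the symmetry of [p] gives
     [p_r = - p_r]. *)
  assert (Z : forall u, pr s u = 0).
  { intros u.
    pose proof (proj1 (C1 s u Hs)) as D1.
    assert (D2 : is_derive (fun r => p (a * b / r) u) s (-1 * pr s u)).
    { apply (is_derive_comp (fun r => p r u) (fun r => a * b / r)).
      - replace (a * b / s) with s by (rewrite <- Hs2; field; lra); exact D1.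
      - auto_derive; [lra|rewrite <- Hs2; field; lra]. }
    apply (is_derive_ext_loc _ (fun r => p r u)) in D2.
    2:{ apply (locally_open_interval a b); auto; intros; symmetry; auto. }
    apply is_derive_unique in D1, D2; rewrite D1 in D2; lra. }
  (* On this circle [U_tt = - r p_r = 0], so [U_t] is constant. *)
  assert (Q : forall u, Derive (U s) u = Derive (U s) 0).
  { intros u; pose proof (Rabs_pos u); pose proof (Rle_abs u); pose proof (Rle_abs (- u)).
    rewrite Rabs_Ropp in *.
    apply (is_derive_0_const (- Rabs u - 1) (Rabs u + 1)); try lra.
    intros v _; evar_last; [apply (C2 s v Hs)|]; change (- (s * pr s v) = 0); rewrite Z; ring. }
  set (c := Derive (U s) 0) in *.
  assert (A : forall u, U s u - c * u = U s 0 - c * 0).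
  { intros u; pose proof (Rabs_pos u); pose proof (Rle_abs u); pose proof (Rle_abs (- u)).
    rewrite Rabs_Ropp in *.
    apply (is_derive_0_const (- Rabs u - 1) (Rabs u + 1) (fun u => U s u - c * u)); try lra.
    intros v _; eapply is_derive_Rminus.
    - apply Derive_correct, (HU s v Hs).
    - apply (is_derive_scal (fun u => u)), (is_derive_id (K := R_AbsRing)).
    - unfold one; simpl; change (0 = Derive (U s) v - c * 1); rewrite Q; ring. }
  (* [U] is affine in [t] on this circle, and periodic, so its slope is 0. *)
  assert (c = 0) as Hc.
  { pose proof (A (2 * PI)) as E; pose proof (PU' s 0 Hs) as P; rewrite Rplus_0_l in P.
    pose proof PI_RGT_0; rewrite P in E; nra. }
  specialize (A t); rewrite Hc in A; lra.
Qed.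

(** Substitution [x = r rho], under which [dx / x] is invariant. *)
Lemma is_RInt_rescale (g : R -> R) (r s l : R) :
  0 < r -> is_RInt (fun x => g x / x) s r l ->
  is_RInt (fun rho => g (r * rho) / rho) (s / r) 1 l.
Proof.
  intros Hr H.
  assert (H' : is_RInt (fun x => g x / x) (r * (s / r) + 0) (r * 1 + 0) l).
  { replace (r * (s / r) + 0) with s by (field; lra).
    now replace (r * 1 + 0) with r by ring. }
  apply is_RInt_comp_lin in H'.
  eapply is_RInt_ext; [|exact H'].
  intros x _; unfold scal; simpl; unfold mult; simpl; rewrite Rplus_0_r.
  unfold Rdiv; rewrite Rinv_mult.
  replace (r * (g (r * x) * (/ r * / x))) with (r * / r * (g (r * x) * / x)) by ring.
  rewrite Rinv_r by lra; ring.
Qed.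

Lemma neumann_integral_formula (a b : R) (phi U u : R -> R -> R) :
  0 < a -> a < b -> neumann_solution a b phi U ->
  (forall t, a * phi a t = b * phi b t) -> U (sqrt (a * b)) 0 = 0 ->
  dirichlet_solution a b (fun r t => r * phi r t) u ->
  forall r t, a <= r <= b -> is_RInt (fun x => u x t / x) (sqrt (a * b)) r (U r t).
Proof.
  intros Ha Hab HN Hphi H0 Hu r t Hr.
  pose proof HN as (HU & CU & _ & _ & Ur & _ & HE & _).
  pose proof (neumann_radial_dirichlet a b phi U Ur Ha Hab HN HE) as HD.
  pose proof (dirichlet_unique a b _ _ _ Ha Hab Hu HD) as E; cbv beta in E.
  pose proof (neumann_mid_circle a b phi U Ur Ha Hab HN HE Hphi t) as M; rewrite H0 in M.
  set (s := sqrt (a * b)) in *.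
  assert (Hs : a < s < b) by now apply sqrt_between.
  (* Clamping makes the integrand continuous on the whole line, so its primitive is differentiable
     everywhere. *)
  set (v := fun x => u (clamp a b x) t / clamp a b x).
  assert (Cv : forall x, continuous v x).
  { intros x; pose proof (clamp_bounds a b x ltac:(lra)).
    apply (continuous_mult (K := R_AbsRing) (fun x => u (clamp a b x) t)).
    - apply (continuity_2d_pt_fst (fun r t => u (clamp a b r) t)).
      apply (jointly_continuous_clamp a b u); [lra|apply Hu].
    - apply (continuous_comp (clamp a b) Rinv); [apply continuous_clamp|].
      apply continuous_Rinv; lra. }
  assert (I : forall x, is_RInt v s x (RInt v s x)).
  { intros x; apply (RInt_correct (V := R_CompleteNormedModule)).
    now apply continuous_ex_RInt. }
  assert (Dv : forall x, is_derive (fun x => RInt v s x) x (v x)).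
  { intros x; apply (is_derive_RInt v _ s); auto; apply filter_forall; auto. }
  (* [h] is 0 at [s] and has zero derivative inside the strip; the end points, where [U] need not be
     differentiable, are reached by continuity. *)
  set (h := fun x => U (clamp a b x) t - RInt v s x).
  assert (Ch : forall x, continuous h x).
  { intros x; apply (continuous_minus (V := R_NormedModule) (fun x => U (clamp a b x) t)).
    - apply (continuity_2d_pt_fst (fun r t => U (clamp a b r) t)).
      apply (jointly_continuous_clamp a b U); auto; lra.
    - apply (ex_derive_continuous (fun x => RInt v s x)); eexists; apply Dv. }
  assert (Dh : forall x, a < x < b -> is_derive h x 0).
  { intros x Hx; eapply is_derive_Rminus; [|apply Dv|].
    - apply (is_derive_ext_loc (fun x => U x t)).
      + apply (locally_open_interval a b); auto; intros y Hy; rewrite clamp_id by lra; auto.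
      + apply Derive_correct, (HU x t Hx).
    - unfold v; rewrite clamp_id, E, (proj2 HE) by (try assumption; lra).
      change (0 = Derive (fun x => U x t) x - x * Derive (fun x => U x t) x / x); field; lra. }
  assert (Zh : h r = 0).
  { apply (continuous_zero_closed a b); auto; intros x Hx.
    rewrite (is_derive_0_const a b h Dh x s Hx Hs).
    unfold h; rewrite clamp_id, M, RInt_point by lra; apply Rminus_0_r. }
  unfold h in Zh; rewrite clamp_id in Zh by lra.
  replace (U r t) with (RInt v s r) by lra.
  eapply is_RInt_ext; [|apply I].
  intros x Hx; unfold v; rewrite clamp_id; auto.
  revert Hx; unfold Rmin, Rmax; destruct Rle_dec; lra.
Qed.

Theorem theorem3 : forall r1 r2 : R, 0 < r1 -> r1 < r2 ->
  (forall phi U u : R -> R -> R,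
     jointly_continuous_on (strip_boundary r1 r2) phi ->
     periodic_on (strip_boundary r1 r2) phi ->
     dirichlet_conditions (phi r1) ->
     dirichlet_conditions (phi r2) ->
     (forall theta, r1 * phi r1 theta = r2 * phi r2 theta) ->
     neumann_solution r1 r2 phi U ->
     U (sqrt (r1 * r2)) 0 = 0 ->
     dirichlet_solution r1 r2 (fun r theta => r * phi r theta) u ->
     forall r theta, closed_strip r1 r2 (r, theta) ->
       is_RInt (fun rho => u (r * rho) theta / rho)
         (sqrt (r1 * r2) / r) 1 (U r theta))
  /\
  (forall phi U Ur : R -> R -> R,
     jointly_continuous_on (strip_boundary r1 r2) phi ->
     periodic_on (strip_boundary r1 r2) phi ->
     RInt (fun theta => phi r1 theta) 0 (2 * PI)
       = RInt (fun theta => phi r2 theta) 0 (2 * PI) ->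
     neumann_solution r1 r2 (fun r theta => phi r theta / r) U ->
     continuous_extension r1 r2 (partial_derive 1 0 U) Ur ->
     the_dirichlet_solution r1 r2 phi (fun r theta => r * Ur r theta)).
Proof.
  intros r1 r2 H1 H12; split.
  - intros phi U u _ _ _ _ Hphi HN H0 Hu r theta Hr.
    apply (is_RInt_rescale (fun x => u x theta)); [unfold closed_strip in Hr; simpl in Hr; lra|].
    now apply (neumann_integral_formula r1 r2 phi).
  - intros phi U Ur _ _ _ HN HE.
    assert (HD : dirichlet_solution r1 r2 phi (fun r theta => r * Ur r theta)).
    { destruct (neumann_radial_dirichlet r1 r2 _ U Ur H1 H12 HN HE) as (A1 & A2 & A3 & A4 & A5).
      split; [|split; [|split; [|split]]]; auto.
      intros r theta Hr; rewrite A5 by exact Hr.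
      field; destruct Hr as [Hr|Hr]; simpl in Hr; lra. }
    split; [exact HD|].
    intros v Hv r theta Hr; now apply (dirichlet_unique r1 r2 phi v _ H1 H12 Hv HD).
Qed.
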